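(* Let $\nu$ range over real numbers with $\nu>-1$, and let $g_{\nu}(z)=2^{\nu}\Gamma(\nu+1)z^{1-\nu}J_{\nu}(z)$. For each $\alpha\in[0,1)$ the equation $$(2\nu+\alpha-2)J_{\nu+1}(1)=\alpha J_{\nu}(1)$$ has a unique root $\nu_{\alpha}$ in $[0,\infty)$, and $g_{\nu}$ is convex of order $\alpha$ in the open unit disk $\mathbb{D}$ if and only if $\nu\geq\nu_{\alpha}$. In particular, $g_{\nu}$ is convex in $\mathbb{D}$ if and only if $\nu\geq1$.
   Context: $J_\nu$ is the Bessel function of the first kind, $J_{\nu}(z)=\sum_{n\geq0}\frac{(-1)^{n}}{n!\,\Gamma(n+\nu+1)}\left(\frac{z}{2}\right)^{2n+\nu}$. The function $g_\nu$ is entire: $g_{\nu}(z)=z-\frac{1}{4(\nu+1)}z^3+\frac{1}{32(\nu+1)(\nu+2)}z^5-\dots$. $\mathbb{D}=\{z\in\mathbb{C}:|z|<1\}$. A function $f$ with $f(0)=f'(0)-1=0$ is convex of order $\alpha\in[0,1)$ in $\mathbb{D}$ if it is analytic and univalent in $\mathbb{D}$ and $\operatorname{Re}\left(1+\frac{zf''(z)}{f'(z)}\right)>\alpha$ for all $z\in\mathbb{D}$; convex means convex of order $0$. *)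

(* Defs.v *)
From Stdlib Require Import Reals Factorial.
From Coquelicot Require Import Coquelicot.

Open Scope R_scope.

(* Euler's integral; it represents the Gamma function for x > 0 only, which
   covers all the arguments n + nu + 1 (nu > -1, n >= 0) needed here. *)
Definition Gamma (x : R) : R :=
  RInt_gen (fun t => Rpower t (x - 1) * exp (- t))
    (at_right 0) (Rbar_locally p_infty).

(* Principal argument, with values in (-PI, PI]; only meaningful for z <> 0. *)
Definition Carg (z : C) : R :=
  if Rle_dec 0 (Im z) then acos (Re z / Cmod z) else - acos (Re z / Cmod z).

(* Principal branch of z ^ a for a real exponent a, with 0 ^ 0 = 1 and
   0 ^ a = 0 for a <> 0. *)
Definition Cpower (z : C) (a : R) : C :=
  if Ceq_dec z 0 then (if Req_EM_T a 0 then RtoC 1 else RtoC 0)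
  else (RtoC (Rpower (Cmod z) a) * (cos (a * Carg z), sin (a * Carg z)))%C.

(* A complex series converges iff its real and imaginary parts do. *)
Definition CSeries (u : nat -> C) : C :=
  (Series (fun n => Re (u n)), Series (fun n => Im (u n))).

Definition BesselJ (nu : R) (z : C) : C :=
  CSeries (fun n =>
    (RtoC ((-1) ^ n / (INR (fact n) * Gamma (INR n + nu + 1)))
     * Cpower (z / 2) (2 * INR n + nu))%C).

(* For z <> 0 the branch cuts of the two powers cancel, so the product is a
   genuine entire function restricted to z <> 0.  At z = 0 the conventions of
   Cpower give the value 0, which is the one that makes it entire. *)
Definition bessel_g (nu : R) (z : C) : C :=
  (RtoC (Rpower 2 nu * Gamma (nu + 1)) * Cpower z (1 - nu) * BesselJ nu z)%C.

Definition in_unit_disk (z : C) : Prop := Cmod z < 1.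

Definition analytic_in_disk (f : C -> C) : Prop :=
  forall z : C, in_unit_disk z ->
    ex_derive (K := C_AbsRing) (V := C_NormedModule) f z.

Definition univalent_in_disk (f : C -> C) : Prop :=
  forall z w : C, in_unit_disk z -> in_unit_disk w -> f z = f w -> z = w.

(* Since division is total, the condition f'(z) <> 0, implicit in writing
   z f''(z) / f'(z) (and automatic for univalent f), is spelled out. *)
Definition convex_of_order (alpha : R) (f : C -> C) : Prop :=
  f 0 = RtoC 0 /\ C_derive f 0 = RtoC 1 /\
  analytic_in_disk f /\ univalent_in_disk f /\
  forall z : C, in_unit_disk z ->
    C_derive f z <> RtoC 0 /\
    Re (1 + z * C_derive (C_derive f) z / C_derive f z)%C > alpha.

Definition convex_in_disk (f : C -> C) : Prop := convex_of_order 0 f.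

(* Main.v *)
Require Import Defs.
From Stdlib Require Import Reals Lra Lia Arith Ranalysis5.
From Coquelicot Require Import Coquelicot.
Open Scope R_scope.

(* Write [w = z^2] and [g_nu(z) = z F(w)].  The quotient [z J_(nu+1)(z) / J_nu(z)] equals
   [w U(w)], where the coefficients [t_k] of [U] come from the Riccati equation of the quotient;
   they are nonnegative, decrease with [nu], and satisfy [t_k <= 2 / (4 (1 + nu))^(k+1)].
   With [Y = (w U)'] one has [g' = F (1 - w U)] and
   [1 + z g'' / g' = 1 - w U - 2 w Y / (1 - w U)].  By positivity of the coefficients the real part
   is, for [|w| < 1] and [nu >= 0], larger than the value at [w = 1], which is increasing in [nu] and
   equals [(2 nu - 2) u / (1 - u)] with [u = J_(nu+1)(1) / J_nu(1)]; setting it equal to [alpha] is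
   the equation of the theorem.  Conversely, for [nu > -1], convexity gives [g' > 0] and
   [g' + z g'' > alpha g'] on [[0, 1)]; the limit at [1] is [2 (nu - 1) J_(nu+1)(1) >=
   alpha (J_nu(1) - J_(nu+1)(1))] up to a positive factor, which forces first [nu >= 1] and then the
   bound by [alpha]. *)

(** * The Gamma function *)

(** The bound on [t_k] is geometric with ratio at most 1/4 once nu >= 0. Then u <= 2/3 < 1, so U
    converges on the closed disk and 1 - w U stays away from 0. For nu close to -1 the quotient has
    a pole inside the disk, so the necessity half never divides by F: it uses the everywhere
    convergent series of g' and (z g')', whose values at 1 involve only F(1) and D(1), where D is
    the series with D = U F. Positivity of D(1) for index nu is positivity of F(1) for index nu + 1.
    No information on zeros of Bessel functions enters. Signs and monotonicity of the [t_k] come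
    from their recursion. Nonvanishing of g', univalence and F(1) > 0 come from one estimate: for nu
    >= 0 the coefficients of g' after the first have absolute sum below 1. The Riccati equation
    serves twice. It generates the [t_k], and it removes the explicit nu from (z g')', which leaves
    only series with nonnegative coefficients decreasing in nu. *)

Lemma ex_RInt_continuous_pos (f : R -> R) (a b : R) :
  (forall x, 0 < x -> continuous f x) -> 0 < a -> a <= b -> ex_RInt f a b.
Proof.
  intros Hc Ha Hab. apply (@ex_RInt_continuous R_CompleteNormedModule).
  intros z Hz. apply Hc. rewrite Rmin_left in Hz; lra.
Qed.

Lemma RInt_enlarge (f : R -> R) (a b c d : R) :
  (forall x, 0 < x -> continuous f x) -> (forall x, 0 < x -> 0 <= f x) ->
  0 < a -> a <= b -> b <= c -> c <= d -> RInt f b c <= RInt f a d.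
Proof.
  intros Hc Hp Ha Hab Hbc Hcd.
  assert (E1 := ex_RInt_continuous_pos f a b Hc Ha Hab).
  assert (E2 := ex_RInt_continuous_pos f b c Hc ltac:(lra) Hbc).
  assert (E3 := ex_RInt_continuous_pos f c d Hc ltac:(lra) Hcd).
  assert (E4 := ex_RInt_continuous_pos f a c Hc ltac:(lra) ltac:(lra)).
  rewrite <- (RInt_Chasles f a c d E4 E3), <- (RInt_Chasles f a b c E1 E2).
  assert (P1 : 0 <= RInt f a b) by (apply RInt_ge_0; trivial; intros; apply Hp; lra).
  assert (P3 : 0 <= RInt f c d) by (apply RInt_ge_0; trivial; intros; apply Hp; lra).
  unfold plus; simpl. lra.
Qed.

(** For a nonnegative integrand the integral grows with the interval, so the supremum over compact
    intervals is the limit. The second conclusion keeps the supremum property, from which positivity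
    of the limit is read off. *)
Lemma is_RInt_gen_pos_bounded (f : R -> R) (M : R) :
  (forall x, 0 < x -> continuous f x) -> (forall x, 0 < x -> 0 <= f x) ->
  (forall a b, 0 < a -> a <= b -> RInt f a b <= M) ->
  exists l, is_RInt_gen f (at_right 0) (Rbar_locally p_infty) l /\
    forall a b, 0 < a -> a <= b -> RInt f a b <= l.
Proof.
  intros Hc Hp HM.
  destruct (completeness (fun y => exists a b, 0 < a /\ a <= b /\ y = RInt f a b))
    as [l [Hub Hlub]].
  - exists M. intros y (a & b & Ha & Hab & ->). auto.
  - exists (RInt f 1 2), 1, 2. repeat split; lra.
  - exists l. split; [|intros a b Ha Hab; apply Hub; exists a, b; auto].
    intros P [eps HP].
    assert (Ex : exists a0 b0, 0 < a0 /\ a0 <= b0 /\ l - eps < RInt f a0 b0).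
    { destruct (Classical_Prop.classic
        (exists a0 b0, 0 < a0 /\ a0 <= b0 /\ l - eps < RInt f a0 b0)) as [H|H]; trivial.
      exfalso. assert (l <= l - eps).
      { apply Hlub. intros y (a & b & Ha & Hab & ->).
        apply Rnot_lt_le. intros Hlt. apply H. exists a, b; auto. }
      destruct eps; simpl in *; lra. }
    destruct Ex as (a0 & b0 & Ha0 & Hab0 & Hl).
    (* Every interval that contains [[a0, b0]] has its integral between [l - eps] and [l]. *)
    apply (Filter_prod _ _ _ (fun a => 0 < a < a0) (fun b => b0 < b)).
    + exists (mkposreal a0 Ha0). intros y Hy H0. split; trivial.
      unfold ball in Hy; simpl in Hy; unfold AbsRing_ball, abs, minus, plus, opp in Hy; simpl in Hy.
      apply Rabs_def2 in Hy. lra.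
    + exists b0. auto.
    + intros a b Ha Hb. exists (RInt f a b). split.
      * apply (@RInt_correct R_CompleteNormedModule).
        apply ex_RInt_continuous_pos; trivial; simpl; lra.
      * apply HP.
        assert (RInt f a0 b0 <= RInt f a b) by (apply RInt_enlarge; trivial; lra).
        assert (RInt f a b <= l) by (apply Hub; exists a, b; repeat split; lra).
        unfold ball; simpl; unfold AbsRing_ball, abs, minus, plus, opp; simpl.
        apply Rabs_def1; destruct eps; simpl in *; lra.
Qed.

Definition gamma_density (x t : R) : R := Rpower t (x - 1) * exp (- t).

(** Integration by parts in differential form; it yields both the convergence of Euler's integral
    and its functional equation. *)
Lemma is_derive_Rpower_exp (x t : R) : 0 < t ->
  is_derive (fun t => Rpower t x * exp (- t)) t
    (x * gamma_density x t - gamma_density (x + 1) t).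
Proof.
  intros Ht. unfold gamma_density.
  replace (x + 1 - 1) with x by ring.
  assert (E : Rpower t (x - 1) = Rpower t x / t).
  { unfold Rminus. rewrite Rpower_plus, Rpower_Ropp, Rpower_1 by trivial. reflexivity. }
  rewrite E. unfold Rpower. auto_derive; [trivial|]. field. lra.
Qed.

Lemma continuous_gamma_density (x t : R) : 0 < t -> continuous (gamma_density x) t.
Proof.
  intros Ht. apply (ex_derive_continuous (V := R_NormedModule)).
  unfold gamma_density, Rpower. auto_derive. trivial.
Qed.

Lemma gamma_density_pos (x t : R) : 0 < gamma_density x t.
Proof. apply Rmult_lt_0_compat; apply exp_pos. Qed.

(* [ln (t / c) <= t / c - 1] with [c = 2 p + 1] gives [p ln t <= t / 2 + p ln c]. *)
Lemma Rpower_exp_le (p : R) : 0 <= p ->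
  exists K, 0 < K /\ forall t, 0 < t -> Rpower t p * exp (- t) <= K * exp (- t / 2).
Proof.
  intros Hp. exists (exp (p * ln (2 * p + 1))). split; [apply exp_pos|].
  intros t Ht. unfold Rpower. rewrite <- !exp_plus.
  assert (H : p * ln t <= t / 2 + p * ln (2 * p + 1)).
  { set (c := 2 * p + 1). assert (Hc : 0 < c) by (unfold c; lra).
    assert (Hq : 0 < t / c) by (apply Rdiv_lt_0_compat; trivial).
    assert (L : ln (t / c) <= t / c - 1).
    { assert (H := exp_ineq1_le (ln (t / c))). rewrite exp_ln in H by trivial. lra. }
    unfold Rdiv in L at 1. rewrite ln_mult, ln_Rinv in L; trivial; [|apply Rinv_0_lt_compat; trivial].
    assert (p * (t / c) <= t / 2).
    { unfold c in *. apply (Rmult_le_reg_r (2 * p + 1)); trivial.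
      field_simplify; [|lra]. nra. }
    assert (p * (ln t + - ln c) <= p * (t / c - 1)) by (apply Rmult_le_compat_l; trivial).
    lra. }
  destruct (Req_dec (p * ln t + - t) (p * ln (2 * p + 1) + - t / 2)) as [->|Hn]; [lra|].
  left. apply exp_increasing. lra.
Qed.

(** The singularity at 0 and the tail are handled together by an explicit antiderivative. Since x
    t^(x-1) e^(-t) = (t^x e^(-t))' + t^x e^(-t) and the last term is at most K e^(-t/2), the density
    lies below [g = G'], and the increments of [G] are bounded. *)
Lemma gamma_density_bounded_integral (x : R) : 0 < x ->
  exists M, forall a b, 0 < a -> a <= b -> RInt (gamma_density x) a b <= M.
Proof.
  intros Hx. destruct (Rpower_exp_le x) as (K & HK & Hb); [lra|].
  exists (3 * K / x). intros a b Ha Hab.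
  set (G := fun t => (Rpower t x * exp (- t) - 2 * K * exp (- t / 2)) / x).
  set (g := fun t => ((x * gamma_density x t - gamma_density (x + 1) t)
             + K * exp (- t / 2)) / x).
  assert (HI : is_RInt g a b (minus (G b) (G a))).
  { apply (@is_RInt_derive R_CompleteNormedModule G g).
    - intros t Ht. rewrite Rmin_left in Ht by trivial. unfold G, g.
      assert (H1 := is_derive_Rpower_exp x t ltac:(lra)).
      assert (H2 : is_derive (fun t => - 2 * K * exp (- t / 2)) t (K * exp (- t / 2))).
      { auto_derive; [trivial|]. change (- t * / 2) with (- t / 2). lra. }
      assert (H3 := is_derive_scal _ _ (/ x) _ (is_derive_plus _ _ _ _ _ H1 H2)).
      eapply is_derive_ext; [|eapply (eq_rect _ (fun l => is_derive _ t l)); [apply H3|]].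
      + intros u. unfold plus; simpl. unfold Rdiv. ring.
      + unfold scal, plus; simpl; unfold mult; simpl. unfold Rdiv. ring.
    - intros t Ht. rewrite Rmin_left in Ht by trivial.
      apply (ex_derive_continuous (V := R_NormedModule)).
      unfold g, gamma_density, Rpower. auto_derive. lra. }
  apply Rle_trans with (RInt g a b).
  - apply RInt_le; trivial.
    + apply ex_RInt_continuous_pos; trivial. apply continuous_gamma_density.
    + exists (minus (G b) (G a)). exact HI.
    + intros t Ht. unfold g. assert (H := Hb t ltac:(lra)).
      assert (E : gamma_density (x + 1) t = Rpower t x * exp (- t))
        by (unfold gamma_density; repeat f_equal; ring).
      rewrite E. apply (Rmult_le_reg_r x); trivial. field_simplify; lra.
  - rewrite (is_RInt_unique _ _ _ _ HI). unfold minus, plus, opp, G; simpl.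
    assert (Hb1 := Hb b ltac:(lra)).
    assert (Ha1 : 0 < Rpower a x * exp (- a)) by (apply Rmult_lt_0_compat; apply exp_pos).
    assert (Ea : exp (- a / 2) <= 1) by (rewrite <- exp_0; left; apply exp_increasing; lra).
    assert (Eb : exp (- b / 2) <= 1) by (rewrite <- exp_0; left; apply exp_increasing; lra).
    assert (Eb0 := exp_pos (- b / 2)).
    apply (Rmult_le_reg_r x); trivial. field_simplify; try lra. nra.
Qed.

Lemma Gamma_eq (x l : R) :
  is_RInt_gen (gamma_density x) (at_right 0) (Rbar_locally p_infty) l -> Gamma x = l.
Proof.
  intros H. change (RInt_gen (gamma_density x) (at_right 0) (Rbar_locally p_infty) = l).
  exact (is_RInt_gen_unique _ _ H).
Qed.

Lemma is_RInt_gen_Gamma (x : R) : 0 < x ->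
  is_RInt_gen (gamma_density x) (at_right 0) (Rbar_locally p_infty) (Gamma x).
Proof.
  intros Hx. destruct (gamma_density_bounded_integral x Hx) as [M HM].
  destruct (is_RInt_gen_pos_bounded (gamma_density x) M) as (l & Hl & _); trivial.
  - apply continuous_gamma_density.
  - intros; left; apply gamma_density_pos.
  - rewrite (Gamma_eq x l Hl). exact Hl.
Qed.

Lemma Gamma_pos (x : R) : 0 < x -> 0 < Gamma x.
Proof.
  intros Hx. destruct (gamma_density_bounded_integral x Hx) as [M HM].
  destruct (is_RInt_gen_pos_bounded (gamma_density x) M) as (l & Hl & Hle); trivial.
  - apply continuous_gamma_density.
  - intros; left; apply gamma_density_pos.
  - rewrite (Gamma_eq x l Hl).
    apply Rlt_le_trans with (RInt (gamma_density x) 1 2); [|apply Hle; lra].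
    apply RInt_gt_0; try lra.
    + intros; apply gamma_density_pos.
    + intros; apply continuous_gamma_density; lra.
Qed.

Lemma filterlim_Rpower_exp_0 (x : R) : 0 < x ->
  filterlim (fun t => Rpower t x * exp (- t)) (at_right 0) (locally 0).
Proof.
  intros Hx. intros P [eps HP].
  (* The radius solves d^x = eps; the factor e^(-t) is below 1. *)
  set (d := Rpower eps (/ x)). assert (Hd : 0 < d) by apply exp_pos.
  exists (mkposreal d Hd). intros y Hy H0.
  unfold ball in Hy; simpl in Hy; unfold AbsRing_ball, abs, minus, plus, opp in Hy; simpl in Hy.
  apply Rabs_def2 in Hy. apply HP.
  unfold ball; simpl; unfold AbsRing_ball, abs, minus, plus, opp; simpl.
  assert (E : Rpower d x = eps).
  { unfold d. rewrite Rpower_mult, Rinv_l, Rpower_1; destruct eps; simpl; lra. }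
  assert (P1 : 0 < Rpower y x) by apply exp_pos.
  assert (P2 : Rpower y x < Rpower d x).
  { apply exp_increasing. apply Rmult_lt_compat_l; trivial. apply ln_increasing; lra. }
  assert (P3 : exp (- y) < 1) by (rewrite <- exp_0; apply exp_increasing; lra).
  assert (P4 := exp_pos (- y)).
  apply Rabs_def1; nra.
Qed.

Lemma filterlim_Rpower_exp_infty (x : R) : 0 < x ->
  filterlim (fun t => Rpower t x * exp (- t)) (Rbar_locally p_infty) (locally 0).
Proof.
  intros Hx. destruct (Rpower_exp_le x) as (K & HK & Hb); [lra|].
  (* The threshold solves K e^(-y/2) = eps; the maximum with 0 keeps [y] positive, as [Rpower]
     requires. *)
  intros P [eps HP]. exists (Rmax 0 (- 2 * ln (eps / K))). intros y Hy. apply HP.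
  assert (Y1 := Rmax_l 0 (- 2 * ln (eps / K))). assert (Y2 := Rmax_r 0 (- 2 * ln (eps / K))).
  unfold ball; simpl; unfold AbsRing_ball, abs, minus, plus, opp; simpl.
  assert (P1 : 0 < Rpower y x * exp (- y)) by (apply Rmult_lt_0_compat; apply exp_pos).
  assert (P2 := Hb y ltac:(lra)).
  assert (P3 : exp (- y / 2) < eps / K).
  { rewrite <- (exp_ln (eps / K)) by (apply Rdiv_lt_0_compat; [apply cond_pos|trivial]).
    apply exp_increasing. lra. }
  assert (P4 : K * exp (- y / 2) < eps).
  { apply (Rmult_lt_compat_l K) in P3; trivial. replace (K * (eps / K)) with (pos eps) in P3 by (field; lra). trivial. }
  apply Rabs_def1; lra.
Qed.

(** Integrate the derivative of t^x e^(-t) over the half line: both boundary values vanish. *)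
Lemma Gamma_succ (x : R) : 0 < x -> Gamma (x + 1) = x * Gamma x.
Proof.
  intros Hx.
  assert (H0 := is_RInt_gen_Gamma x Hx).
  assert (H1 := is_RInt_gen_Gamma (x + 1) ltac:(lra)).
  (* Eventually the whole interval of integration is positive, so each pointwise identity is
     available on it. *)
  assert (Hd : filter_prod (at_right 0) (Rbar_locally p_infty)
     (fun ab : R * R => forall t, Rmin (fst ab) (snd ab) <= t <= Rmax (fst ab) (snd ab) -> 0 < t)).
  { apply (Filter_prod _ _ _ (fun a => 0 < a) (fun b => 0 < b)).
    - exists (mkposreal 1 Rlt_0_1). auto.
    - exists 0. auto.
    - intros a b Ha Hb t [Ht _]. simpl in Ht. apply Rlt_le_trans with (Rmin a b); trivial.
      apply Rmin_glb_lt; trivial. }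
  assert (HD : is_RInt_gen (Derive (fun t => Rpower t x * exp (- t)))
            (at_right 0) (Rbar_locally p_infty) (0 - 0)).
  { apply is_RInt_gen_Derive; try typeclasses eauto.
    - revert Hd. apply filter_imp. intros ab Hab t Ht. eexists. apply is_derive_Rpower_exp. auto.
    - revert Hd. apply filter_imp. intros ab Hab t Ht. specialize (Hab t Ht).
      apply (continuous_ext_loc _ (fun t => x * gamma_density x t - gamma_density (x + 1) t)).
      + exists (mkposreal t Hab). intros y Hy. symmetry. apply is_derive_unique.
        apply is_derive_Rpower_exp.
        unfold ball in Hy; simpl in Hy; unfold AbsRing_ball, abs, minus, plus, opp in Hy; simpl in Hy.
        apply Rabs_def2 in Hy. lra.
      + apply (continuous_minus (V := R_NormedModule)).
        * apply (continuous_scal_r (K := R_AbsRing) (V := R_NormedModule)).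
          apply continuous_gamma_density; trivial.
        * apply continuous_gamma_density; trivial.
    - apply filterlim_Rpower_exp_0; trivial.
    - apply filterlim_Rpower_exp_infty; trivial. }
  assert (HS : is_RInt_gen (gamma_density (x + 1)) (at_right 0) (Rbar_locally p_infty)
     (minus (scal x (Gamma x)) (0 - 0))).
  { apply (is_RInt_gen_ext (fun t => minus (scal x (gamma_density x t))
       (Derive (fun t => Rpower t x * exp (- t)) t))).
    - revert Hd. apply filter_imp. intros ab Hab t Ht.
      assert (E := is_derive_unique _ _ _ (is_derive_Rpower_exp x t (Hab t ltac:(lra)))).
      unfold minus, plus, opp, scal; simpl; unfold mult; simpl.
      replace (Derive (fun t => Rpower t x * exp (- t)) t) with
        (x * gamma_density x t - gamma_density (x + 1) t) by (symmetry; exact E). ring.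
    - exact (is_RInt_gen_minus _ _ _ _ (is_RInt_gen_scal _ x _ H0) HD). }
  rewrite (Gamma_eq _ _ HS). unfold minus, plus, opp, scal; simpl; unfold mult; simpl. ring.
Qed.

(** * Absolutely convergent complex series *)

Definition Cabs_summable (u : nat -> C) : Prop := ex_series (fun n => Cmod (u n)).

Lemma im_le_Cmod (c : C) : Rabs (Im c) <= Cmod c.
Proof. eapply Rle_trans; [apply Rmax_r|apply (Rmax_Cmod c)]. Qed.

Lemma ex_series_Rabs_le (a b : nat -> R) :
  (forall n, Rabs (a n) <= b n) -> ex_series b -> ex_series (fun n => Rabs (a n)).
Proof.
  intros H Hb. apply (@ex_series_le R_AbsRing R_CompleteNormedModule _ b); trivial.
  intros n. unfold norm; simpl. unfold abs; simpl. rewrite Rabs_Rabsolu. apply H.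
Qed.

Lemma ex_series_le_abs (a b : nat -> R) :
  (forall n, Rabs (a n) <= b n) -> ex_series b -> ex_series a.
Proof. intros H Hb. apply ex_series_Rabs. eapply ex_series_Rabs_le; eauto. Qed.

Lemma Cabs_summable_le (u : nat -> C) (b : nat -> R) :
  (forall n, Cmod (u n) <= b n) -> ex_series b -> Cabs_summable u.
Proof.
  intros H Hb. apply (ex_series_le_abs _ b); trivial.
  intros n. rewrite Rabs_pos_eq; trivial. apply Cmod_ge_0.
Qed.

Lemma Cabs_summable_Re (u : nat -> C) :
  Cabs_summable u -> ex_series (fun n => Rabs (Re (u n))).
Proof. apply ex_series_Rabs_le. intros n; apply re_le_Cmod. Qed.

Lemma Cabs_summable_Im (u : nat -> C) :
  Cabs_summable u -> ex_series (fun n => Rabs (Im (u n))).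
Proof. apply ex_series_Rabs_le. intros n; apply im_le_Cmod. Qed.

Lemma CSeries_ext (u v : nat -> C) : (forall n, u n = v n) -> CSeries u = CSeries v.
Proof. intros H. unfold CSeries. f_equal; apply Series_ext; intros n; rewrite H; trivial. Qed.

Lemma CSeries_RtoC (a : nat -> R) : CSeries (fun n => RtoC (a n)) = RtoC (Series a).
Proof.
  unfold CSeries, RtoC, Re, Im; simpl. f_equal.
  (* Writing the zero terms as [0 * 0] lets [Series_scal_l] evaluate the sum; the same device recurs
     below. *)
  rewrite (Series_ext _ (fun n => 0 * 0)) by (intros; ring). rewrite Series_scal_l. ring.
Qed.

Lemma CSeries_plus (u v : nat -> C) : Cabs_summable u -> Cabs_summable v ->
  CSeries (fun n => u n + v n)%C = (CSeries u + CSeries v)%C.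
Proof.
  intros Hu Hv. unfold CSeries, Cplus, Re, Im; simpl. f_equal; apply Series_plus;
  apply ex_series_Rabs; (apply Cabs_summable_Re || apply Cabs_summable_Im); trivial.
Qed.

Lemma CSeries_scal (c : C) (u : nat -> C) : Cabs_summable u ->
  CSeries (fun n => c * u n)%C = (c * CSeries u)%C.
Proof.
  intros Hu. assert (H1 := ex_series_Rabs _ (Cabs_summable_Re _ Hu)).
  assert (H2 := ex_series_Rabs _ (Cabs_summable_Im _ Hu)).
  unfold CSeries, Cmult, Re, Im in *; simpl. f_equal.
  - rewrite <- !Series_scal_l. apply Series_minus;
    apply (ex_series_scal_l (V := R_NormedModule)); trivial.
  - rewrite <- !Series_scal_l. apply Series_plus;
    apply (ex_series_scal_l (V := R_NormedModule)); trivial.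
Qed.

Lemma CSeries_incr_1 (u : nat -> C) : Cabs_summable u ->
  CSeries u = (u 0%nat + CSeries (fun n => u (S n)))%C.
Proof.
  intros Hu. unfold CSeries, Cplus; simpl. f_equal.
  - apply (Series_incr_1 (fun n => Re (u n))), ex_series_Rabs, Cabs_summable_Re, Hu.
  - apply (Series_incr_1 (fun n => Im (u n))), ex_series_Rabs, Cabs_summable_Im, Hu.
Qed.

Lemma Re_CSeries_le (u : nat -> C) : Cabs_summable u ->
  Re (CSeries u) <= Series (fun n => Cmod (u n)).
Proof.
  intros Hu. eapply Rle_trans; [apply Rle_abs|].
  eapply Rle_trans; [apply (Series_Rabs (fun n => Re (u n))), Cabs_summable_Re, Hu|].
  apply Series_le; trivial. intros n. split; [apply Rabs_pos|apply re_le_Cmod].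
Qed.

(* Rotate the sum onto the positive axis and compare real parts. *)
Lemma Cmod_CSeries_le (u : nat -> C) : Cabs_summable u ->
  Cmod (CSeries u) <= Series (fun n => Cmod (u n)).
Proof.
  intros Hu. destruct (Req_dec (Cmod (CSeries u)) 0) as [E|E].
  - rewrite E. rewrite <- (Rmult_0_l (Series (fun _ => 0))), <- Series_scal_l.
    apply Series_le; trivial. intros n. split; [lra|]. rewrite Rmult_0_l. apply Cmod_ge_0.
  - assert (Hp : 0 < Cmod (CSeries u)) by (assert (H := Cmod_ge_0 (CSeries u)); lra).
    set (z := CSeries u) in *. set (c := (Cconj z / RtoC (Cmod z))%C).
    assert (HC : RtoC (Cmod z) <> 0) by (intros H; apply RtoC_inj in H; lra).
    assert (Hc : Cmod c = 1).
    { unfold c. rewrite Cmod_div, Cmod_conj, Cmod_R, Rabs_pos_eq; trivial; [field; lra|lra]. }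
    assert (Hz : (c * z)%C = RtoC (Cmod z)).
    { unfold c. replace (Cconj z / Cmod z * z)%C with ((z * Cconj z) / Cmod z)%C by (field; trivial).
      rewrite <- Cmod2_conj. rewrite RtoC_pow. field; trivial. }
    assert (Hs : Cabs_summable (fun n => c * u n)%C).
    { apply (Cabs_summable_le _ (fun n => Cmod (u n))); trivial.
      intros n. rewrite Cmod_mult, Hc. lra. }
    unfold z in Hz at 1. rewrite <- CSeries_scal in Hz by trivial.
    assert (HR : Cmod z = Re (CSeries (fun n => c * u n)%C)) by (rewrite Hz; trivial).
    rewrite HR. eapply Rle_trans; [apply Re_CSeries_le, Hs|].
    right. apply Series_ext. intros n. rewrite Cmod_mult, Hc. ring.
Qed.

Fixpoint Csum (u : nat -> C) (n : nat) : C :=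
  match n with O => u O | S m => (Csum u m + u (S m))%C end.

Lemma Csum_Re (u : nat -> C) (n : nat) : Re (Csum u n) = sum_f_R0 (fun k => Re (u k)) n.
Proof. induction n as [|n IH]; simpl; trivial. rewrite <- IH. reflexivity. Qed.

Lemma Csum_Im (u : nat -> C) (n : nat) : Im (Csum u n) = sum_f_R0 (fun k => Im (u k)) n.
Proof. induction n as [|n IH]; simpl; trivial. rewrite <- IH. reflexivity. Qed.

(** Four real Cauchy products, one for each pairing of real and imaginary parts, are recombined. *)
Lemma CSeries_mult (u v : nat -> C) : Cabs_summable u -> Cabs_summable v ->
  CSeries (fun n => Csum (fun k => u k * v (n - k)%nat)%C n) = (CSeries u * CSeries v)%C.
Proof.
  intros Hu Hv.
  assert (R1 := Cabs_summable_Re _ Hu). assert (I1 := Cabs_summable_Im _ Hu).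
  assert (R2 := Cabs_summable_Re _ Hv). assert (I2 := Cabs_summable_Im _ Hv).
  assert (SR1 := Series_correct _ (ex_series_Rabs _ R1)).
  assert (SI1 := Series_correct _ (ex_series_Rabs _ I1)).
  assert (SR2 := Series_correct _ (ex_series_Rabs _ R2)).
  assert (SI2 := Series_correct _ (ex_series_Rabs _ I2)).
  assert (RR := is_series_mult _ _ _ _ SR1 SR2 R1 R2).
  assert (II := is_series_mult _ _ _ _ SI1 SI2 I1 I2).
  assert (RI := is_series_mult _ _ _ _ SR1 SI2 R1 I2).
  assert (IR := is_series_mult _ _ _ _ SI1 SR2 I1 R2).
  change (CSeries u * CSeries v)%C with
    (Series (fun n => Re (u n)) * Series (fun n => Re (v n))
       - Series (fun n => Im (u n)) * Series (fun n => Im (v n)),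
     Series (fun n => Re (u n)) * Series (fun n => Im (v n))
       + Series (fun n => Im (u n)) * Series (fun n => Re (v n))).
  unfold CSeries. f_equal; apply is_series_unique.
  - eapply is_series_ext; [|exact (is_series_minus _ _ _ _ RR II)].
    intros n. rewrite Csum_Re. unfold plus, opp; simpl.
    rewrite <- (Rmult_1_l (sum_f_R0 (fun k => Im (u k) * Im (v (n - k)%nat)) n)).
    rewrite Ropp_mult_distr_l, scal_sum, <- sum_plus. apply sum_eq.
    intros i _. unfold Re, Im; simpl. ring.
  - eapply is_series_ext; [|exact (is_series_plus _ _ _ _ RI IR)].
    intros n. rewrite Csum_Im. unfold plus; simpl.
    rewrite <- sum_plus. apply sum_eq. intros i _. unfold Re, Im; simpl. ring.
Qed.

(** * Power series on the closed unit disk and their termwise derivatives *)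

Lemma Cmod_pow_le_1 (z : C) (n : nat) : Cmod z <= 1 -> Cmod (z ^ n)%C <= 1.
Proof.
  intros Hz. rewrite Cmod_pow. rewrite <- (pow1 n). apply pow_incr.
  split; [apply Cmod_ge_0|trivial].
Qed.

Lemma Cmod_pow_diff (z w : C) (n : nat) : Cmod z <= 1 -> Cmod w <= 1 ->
  Cmod (z ^ n - w ^ n)%C <= INR n * Cmod (z - w)%C.
Proof.
  intros Hz Hw. induction n as [|n IH].
  - simpl. replace (1 - 1)%C with (RtoC 0) by ring. rewrite Cmod_0. lra.
  - rewrite !Cpow_S, S_INR.
    replace (z * z ^ n - w * w ^ n)%C with (z * (z ^ n - w ^ n) + (z - w) * w ^ n)%C by ring.
    eapply Rle_trans; [apply Cmod_triangle|]. rewrite !Cmod_mult.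
    assert (H1 := Cmod_ge_0 (z ^ n - w ^ n)%C). assert (H2 := Cmod_ge_0 (z - w)%C).
    assert (H3 := Cmod_pow_le_1 w n Hw). assert (H4 := Cmod_ge_0 z). nra.
Qed.

(** The remainder for n + 1 is w times the remainder for n plus (z^n - w^n)(z - w), and n^2 + n <=
    (n + 1)^2. At n = 0 the value of [pred 0] is multiplied by 0. *)
Lemma Cmod_pow_diff2 (z w : C) (n : nat) : Cmod z <= 1 -> Cmod w <= 1 ->
  Cmod (z ^ n - w ^ n - RtoC (INR n) * w ^ pred n * (z - w))%C <= INR n ^ 2 * Cmod (z - w)%C ^ 2.
Proof.
  intros Hz Hw. induction n as [|n IH].
  - simpl. replace (1 - 1 - 0 * 1 * (z - w))%C with (RtoC 0) by ring. rewrite Cmod_0. lra.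
  - replace (z ^ S n - w ^ S n - RtoC (INR (S n)) * w ^ pred (S n) * (z - w))%C
      with (w * (z ^ n - w ^ n - RtoC (INR n) * w ^ pred n * (z - w))
         + (z ^ n - w ^ n) * (z - w))%C.
    + eapply Rle_trans; [apply Cmod_triangle|]. rewrite !Cmod_mult, S_INR.
      assert (H1 := Cmod_ge_0 (z ^ n - w ^ n - RtoC (INR n) * w ^ pred n * (z - w))%C).
      assert (H2 := Cmod_ge_0 (z - w)%C). assert (H3 := Cmod_pow_diff z w n Hz Hw).
      assert (H4 := Cmod_ge_0 w). assert (H5 := pos_INR n).
      assert (Cmod (z ^ n - w ^ n)%C * Cmod (z - w)%C <= INR n * Cmod (z - w)%C * Cmod (z - w)%C)
        by (apply Rmult_le_compat_r; trivial).
      nra.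
    + rewrite S_INR, RtoC_plus. destruct n as [|n]; simpl; ring.
Qed.

(* The exponents are a free parameter so that the powers [z ^ (2 n + 1)] need no substitution. *)
Definition Cpser (e : nat -> nat) (c : nat -> R) (z : C) : C :=
  CSeries (fun n => RtoC (c n) * z ^ e n)%C.

Lemma Cmod_term (c : R) (z : C) (n : nat) :
  Cmod z <= 1 -> Cmod (RtoC c * z ^ n)%C <= Rabs c.
Proof.
  intros Hz. rewrite Cmod_mult, Cmod_R. assert (H := Cmod_pow_le_1 z n Hz).
  assert (H1 := Rabs_pos c). nra.
Qed.

Lemma Cpser_summable (e : nat -> nat) (c : nat -> R) (z : C) :
  Cmod z <= 1 -> ex_series (fun n => Rabs (c n)) ->
  Cabs_summable (fun n => RtoC (c n) * z ^ e n)%C.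
Proof. intros Hz. apply Cabs_summable_le. intros n. apply Cmod_term; trivial. Qed.

Lemma CSeries_minus (u v : nat -> C) : Cabs_summable u -> Cabs_summable v ->
  CSeries (fun n => u n - v n)%C = (CSeries u - CSeries v)%C.
Proof.
  intros Hu Hv. unfold Cminus.
  replace (- CSeries v)%C with (RtoC (-1) * CSeries v)%C by ring.
  rewrite <- CSeries_scal by trivial. rewrite <- CSeries_plus; trivial.
  - apply CSeries_ext. intros n. ring.
  - apply (Cabs_summable_le _ (fun n => Cmod (v n))); trivial.
    intros n. rewrite Cmod_mult, Cmod_R, Rabs_left; lra.
Qed.

Lemma Cmod_Cpser_le (e : nat -> nat) (c : nat -> R) (z : C) :
  Cmod z <= 1 -> ex_series (fun n => Rabs (c n)) ->
  Cmod (Cpser e c z) <= Series (fun n => Rabs (c n)).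
Proof.
  intros Hz Hc. eapply Rle_trans; [apply Cmod_CSeries_le, Cpser_summable; trivial|].
  apply Series_le; trivial. intros n. split; [apply Cmod_ge_0|apply Cmod_term; trivial].
Qed.

Lemma Cabs_summable_minus (u v : nat -> C) : Cabs_summable u -> Cabs_summable v ->
  Cabs_summable (fun n => u n - v n)%C.
Proof.
  intros Hu Hv. apply (Cabs_summable_le _ (fun n => Cmod (u n) + Cmod (v n))).
  - intros n. unfold Cminus. eapply Rle_trans; [apply Cmod_triangle|]. rewrite Cmod_opp. lra.
  - apply (ex_series_plus (V := R_NormedModule)); trivial.
Qed.

(** The explicit constant matters: a value below 1 gives univalence of g_nu. The closed disk matters
    too, since limits at the boundary point 1 are taken through this bound. *)
Lemma Cpser_Lipschitz (e : nat -> nat) (c : nat -> R) (z w : C) :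
  Cmod z <= 1 -> Cmod w <= 1 ->
  ex_series (fun n => Rabs (c n)) -> ex_series (fun n => INR (e n) * Rabs (c n)) ->
  Cmod (Cpser e c z - Cpser e c w)%C <=
  Series (fun n => INR (e n) * Rabs (c n)) * Cmod (z - w)%C.
Proof.
  intros Hz Hw H0 H1. unfold Cpser.
  assert (S1 := Cpser_summable e c z Hz H0). assert (S2 := Cpser_summable e c w Hw H0).
  rewrite <- CSeries_minus by trivial.
  eapply Rle_trans; [apply Cmod_CSeries_le, Cabs_summable_minus; trivial|].
  rewrite <- Series_scal_r. apply Series_le.
  - intros n. split; [apply Cmod_ge_0|].
    replace (c n * z ^ e n - c n * w ^ e n)%C with (RtoC (c n) * (z ^ e n - w ^ e n))%C by ring.
    rewrite Cmod_mult, Cmod_R.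
    assert (H := Cmod_pow_diff z w (e n) Hz Hw). assert (H2 := Rabs_pos (c n)). nra.
  - apply ex_series_scal_r; trivial.
Qed.

(** Summing the quadratic remainders of the powers justifies termwise differentiation without a
    radius of convergence: summability of n^2 |c_n| on the closed disk is enough. *)
Lemma Cpser_diff2 (e : nat -> nat) (c : nat -> R) (z w : C) :
  Cmod z <= 1 -> Cmod w <= 1 ->
  ex_series (fun n => Rabs (c n)) -> ex_series (fun n => INR (e n) * Rabs (c n)) ->
  ex_series (fun n => INR (e n) ^ 2 * Rabs (c n)) ->
  Cmod (Cpser e c z - Cpser e c w
        - Cpser (fun n => pred (e n)) (fun n => (INR (e n) * c n)%R) w * (z - w))%C <=
  Series (fun n => INR (e n) ^ 2 * Rabs (c n)) * Cmod (z - w)%C ^ 2.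
Proof.
  intros Hz Hw H0 H1 H2. unfold Cpser.
  assert (S1 := Cpser_summable e c z Hz H0). assert (S2 := Cpser_summable e c w Hw H0).
  assert (A : ex_series (fun n => Rabs (INR (e n) * c n))).
  { eapply ex_series_ext; [|exact H1]. intros n; simpl.
    rewrite Rabs_mult, (Rabs_pos_eq (INR _)); trivial. apply pos_INR. }
  assert (S3 := Cpser_summable (fun n => pred (e n)) _ w Hw A).
  assert (S4 : Cabs_summable (fun n => (z - w) * (RtoC (INR (e n) * c n)%R * w ^ pred (e n)))%C).
  { apply (Cabs_summable_le _ (fun n => Cmod (z - w)%C *
        Cmod (RtoC (INR (e n) * c n)%R * w ^ pred (e n))%C)).
    - intros n. rewrite Cmod_mult. lra.
    - apply (ex_series_scal_l (V := R_NormedModule)); trivial. }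
  rewrite (Cmult_comm _ (z - w)%C), <- CSeries_scal by trivial.
  rewrite <- CSeries_minus by trivial. rewrite <- CSeries_minus; trivial; [|apply Cabs_summable_minus; trivial].
  eapply Rle_trans; [apply Cmod_CSeries_le; repeat apply Cabs_summable_minus; trivial|].
  rewrite <- Series_scal_r. apply Series_le.
  - intros n. split; [apply Cmod_ge_0|].
    replace (c n * z ^ e n - c n * w ^ e n - (z - w) * (RtoC (INR (e n) * c n)%R * w ^ pred (e n)))%C
      with (RtoC (c n) * (z ^ e n - w ^ e n - RtoC (INR (e n)) * w ^ pred (e n) * (z - w)))%C
      by (rewrite RtoC_mult; ring).
    rewrite Cmod_mult, Cmod_R.
    assert (H := Cmod_pow_diff2 z w (e n) Hz Hw). assert (H3 := Rabs_pos (c n)). nra.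
  - apply ex_series_scal_r; trivial.
Qed.

Lemma is_C_derive_quadratic (f : C -> C) (z l : C) (d M : R) : 0 < d ->
  (forall w, Cmod (w - z)%C < d -> Cmod (f w - f z - l * (w - z))%C <= M * Cmod (w - z)%C ^ 2) ->
  is_derive (K := C_AbsRing) (V := C_NormedModule) f z l.
Proof.
  intros Hd H. split.
  - apply (is_linear_scal_l (K := C_AbsRing) (V := C_NormedModule)).
  (* The definition of the differential quantifies over all limits of the filter; the only one is
     [z]. *)
  - intros x Hx. assert (E : z = x).
    { apply (is_filter_lim_locally_unique (K := C_AbsRing) (V := AbsRing_NormedModule C_AbsRing)); trivial. }
    subst x. intros eps.
    (* [Rabs M + 1] is a positive divisor whatever the sign of [M]. *)
    assert (HM : 0 < Rabs M + 1) by (assert (H0 := Rabs_pos M); lra).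
    assert (Hr : 0 < Rmin d (eps / (Rabs M + 1))).
    { apply Rmin_glb_lt; trivial. apply Rdiv_lt_0_compat; [apply cond_pos|trivial]. }
    exists (mkposreal _ Hr). intros w Hw.
    change (Cmod (w - z)%C < Rmin d (eps / (Rabs M + 1))) in Hw.
    assert (W1 := Rlt_le_trans _ _ _ Hw (Rmin_l _ _)).
    assert (W2 := Rlt_le_trans _ _ _ Hw (Rmin_r _ _)).
    specialize (H w W1).
    change (Cmod (f w - f z - (w - z) * l)%C <= eps * Cmod (w - z)%C).
    rewrite (Cmult_comm _ l). eapply Rle_trans; [exact H|].
    assert (H0 := Cmod_ge_0 (w - z)%C). assert (H1 := Rle_abs M).
    assert (Cmod (w - z)%C * (Rabs M + 1) <= eps).
    { assert (W3 := Rmult_le_compat_r (Rabs M + 1) _ _ ltac:(lra) (Rlt_le _ _ W2)).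
      replace (eps / (Rabs M + 1) * (Rabs M + 1)) with (pos eps) in W3 by (field; lra). trivial. }
    simpl. rewrite Rmult_1_r, <- Rmult_assoc. apply Rmult_le_compat_r; trivial. nra.
Qed.

Lemma is_C_derive_Cpser (e : nat -> nat) (c : nat -> R) (z : C) :
  in_unit_disk z ->
  ex_series (fun n => Rabs (c n)) -> ex_series (fun n => INR (e n) * Rabs (c n)) ->
  ex_series (fun n => INR (e n) ^ 2 * Rabs (c n)) ->
  is_derive (K := C_AbsRing) (V := C_NormedModule) (Cpser e c) z
    (Cpser (fun n => pred (e n)) (fun n => INR (e n) * c n) z).
Proof.
  intros Hz H0 H1 H2. unfold in_unit_disk in Hz.
  apply (is_C_derive_quadratic _ _ _ (1 - Cmod z)
     (Series (fun n => INR (e n) ^ 2 * Rabs (c n)))); [lra|].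
  intros w Hw. apply Cpser_diff2; trivial; [|lra].
  replace w with ((w - z) + z)%C by ring. eapply Rle_trans; [apply Cmod_triangle|]. lra.
Qed.

(** * Coefficients *)

Definition conv (a b : nat -> R) (n : nat) : R :=
  sum_f_R0 (fun k => a k * b (n - k)%nat) n.

Lemma conv_ext (a a' b b' : nat -> R) (n : nat) :
  (forall i, (i <= n)%nat -> a i = a' i) -> (forall i, (i <= n)%nat -> b i = b' i) ->
  conv a b n = conv a' b' n.
Proof.
  intros Ha Hb. apply sum_eq. intros i Hi. rewrite Ha, Hb by lia. reflexivity.
Qed.

Lemma conv_S (a b : nat -> R) (n : nat) :
  conv a b (S n) = a 0%nat * b (S n) + conv (fun i => a (S i)) b n.
Proof. unfold conv. rewrite decomp_sum by lia. reflexivity. Qed.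

Lemma conv_S_r (a b : nat -> R) (n : nat) :
  conv a b (S n) = conv a (fun i => b (S i)) n + a (S n) * b 0%nat.
Proof.
  unfold conv. rewrite tech5. rewrite Nat.sub_diag. f_equal.
  apply sum_eq. intros i Hi. do 2 f_equal. lia.
Qed.

Lemma conv_lin_l (c c' : R) (a a' b : nat -> R) (n : nat) :
  conv (fun i => c * a i + c' * a' i) b n = c * conv a b n + c' * conv a' b n.
Proof.
  unfold conv. rewrite !scal_sum, <- sum_plus. apply sum_eq. intros; ring.
Qed.

Lemma conv_scal_l (c : R) (a b : nat -> R) (n : nat) :
  conv (fun i => c * a i) b n = c * conv a b n.
Proof. unfold conv. rewrite scal_sum. apply sum_eq. intros; ring. Qed.

Lemma conv_scal_r (c : R) (a b : nat -> R) (n : nat) :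
  conv a (fun i => c * b i) n = c * conv a b n.
Proof. unfold conv. rewrite scal_sum. apply sum_eq. intros; ring. Qed.

(** Peeling off the head of [a] reduces n + 1 to n for the shifted sequence, hence the induction
    with [a] general. *)
Lemma conv_assoc (a b c : nat -> R) (n : nat) :
  conv (conv a b) c n = conv a (conv b c) n.
Proof.
  revert a. induction n as [|n IH]; intros a; [unfold conv; simpl; ring|].
  rewrite !conv_S, <- IH.
  rewrite (conv_ext _ (fun i => a 0%nat * b (S i) + 1 * conv (fun i => a (S i)) b i) c c).
  - rewrite conv_lin_l. unfold conv at 1; simpl. ring.
  - intros i _. rewrite conv_S. ring.
  - trivial.
Qed.

Lemma conv_nonneg (a b : nat -> R) (n : nat) :
  (forall i, (i <= n)%nat -> 0 <= a i) -> (forall i, (i <= n)%nat -> 0 <= b i) ->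
  0 <= conv a b n.
Proof.
  intros Ha Hb. unfold conv. rewrite <- (Rmult_0_l (INR (S n))), <- sum_cte.
  apply sum_Rle. intros i Hi. apply Rmult_le_pos; [apply Ha|apply Hb]; lia.
Qed.

Lemma conv_le (a b a' b' : nat -> R) (n : nat) :
  (forall i, (i <= n)%nat -> 0 <= a i <= a' i) ->
  (forall i, (i <= n)%nat -> 0 <= b i <= b' i) -> conv a b n <= conv a' b' n.
Proof.
  intros Ha Hb. apply sum_Rle. intros i Hi.
  assert (H1 := Ha i Hi). assert (H2 := Hb (n - i)%nat ltac:(lia)).
  apply Rmult_le_compat; lra.
Qed.

(** The coefficients of F, in closed form (-1)^n / (4^n n! (nu+1)...(nu+n)). The recursion is the
    Bessel differential equation and keeps [Gamma] out of the estimates. *)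
Fixpoint bcoef (nu : R) (n : nat) : R :=
  match n with
  | O => 1
  | S m => - bcoef nu m / (4 * INR (S m) * (nu + INR (S m)))
  end.

(* Approximations of the expansion of [u = z J_(nu+1)(z) / J_nu(z)] in powers of [w = z^2];
   the recursion is the Riccati equation [z u' = w - 2 nu u + u^2] for [u = w * sum_k t_k w^k]. *)
Fixpoint tcoef_upto (nu : R) (m k : nat) : R :=
  match m, k with
  | O, _ => 0
  | S _, O => / (2 * (1 + nu))
  | S m', S j => conv (tcoef_upto nu m') (tcoef_upto nu m') j / (2 * (INR j + 2 + nu))
  end.

(** The argument [m] of [tcoef_upto] is fuel for the course-of-values recursion, and [S k] is enough
    for index [k]. Classically this is twice a Rayleigh sum: 2 times the sum of j^(-2k-2) over the
    positive zeros j of J_nu. *)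
Definition tcoef (nu : R) (k : nat) : R := tcoef_upto nu (S k) k.

Lemma tcoef_upto_stable (nu : R) (m k : nat) :
  (k < m)%nat -> tcoef_upto nu m k = tcoef nu k.
Proof.
  unfold tcoef. revert m. induction k as [k IH] using (well_founded_ind Nat.lt_wf_0). intros m Hm.
  destruct m as [|m]; [lia|]. destruct k as [|j]; [reflexivity|].
  cbn [tcoef_upto]. f_equal.
  assert (E : forall i, (i <= j)%nat -> tcoef_upto nu m i = tcoef_upto nu (S j) i).
  { intros i Hi. rewrite (IH i) by lia. symmetry. apply IH; lia. }
  apply conv_ext; exact E.
Qed.

Lemma tcoef_0 (nu : R) : tcoef nu 0 = / (2 * (1 + nu)).
Proof. reflexivity. Qed.

Lemma tcoef_S (nu : R) (j : nat) :
  tcoef nu (S j) = conv (tcoef nu) (tcoef nu) j / (2 * (INR j + 2 + nu)).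
Proof.
  unfold tcoef at 1. cbn [tcoef_upto]. f_equal.
  apply conv_ext; intros i Hi; apply (tcoef_upto_stable nu (S j)); lia.
Qed.

Lemma tcoef_nonneg (nu : R) (k : nat) : -1 < nu -> 0 <= tcoef nu k.
Proof.
  intros Hnu. induction k as [k IH] using (well_founded_ind Nat.lt_wf_0). destruct k as [|j].
  - rewrite tcoef_0. left. apply Rinv_0_lt_compat. lra.
  - rewrite tcoef_S. assert (H := pos_INR j). apply Rmult_le_pos.
    + apply conv_nonneg; intros i Hi; apply IH; lia.
    + left. apply Rinv_0_lt_compat. lra.
Qed.

(** The ratio [rho] makes the case k = 0 an equality. In the step each of the j + 1 products is at
    most 4 rho^(j+2), and dividing by 2 (j + 2 + nu) leaves at most 2 rho^(j+2) because j + 1 <= j +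
    2 + nu. *)
Lemma tcoef_le (nu : R) (k : nat) : -1 < nu -> tcoef nu k <= 2 * (/ (4 * (1 + nu))) ^ S k.
Proof.
  intros Hnu. set (rho := / (4 * (1 + nu))).
  assert (Hr : 0 < rho) by (apply Rinv_0_lt_compat; lra).
  induction k as [k IH] using (well_founded_ind Nat.lt_wf_0). destruct k as [|j].
  - rewrite tcoef_0. unfold rho. right. simpl. field. lra.
  - rewrite tcoef_S. assert (H := pos_INR j).
    assert (B : conv (tcoef nu) (tcoef nu) j <= 4 * rho ^ S (S j) * INR (S j)).
    { unfold conv. rewrite <- sum_cte. apply sum_Rle. intros i Hi.
      replace (4 * rho ^ S (S j)) with ((2 * rho ^ S i) * (2 * rho ^ S (j - i))).
      - apply Rmult_le_compat; try apply tcoef_nonneg; trivial; apply IH; lia.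
      - replace (S (S j)) with (S i + S (j - i))%nat by lia. rewrite pow_add. ring. }
    assert (P : 0 < rho ^ S (S j)) by (apply pow_lt; trivial).
    rewrite S_INR in B. apply (Rmult_le_reg_r (2 * (INR j + 2 + nu))); [lra|].
    unfold Rdiv. rewrite Rmult_assoc, Rinv_l by lra. nra.
Qed.

(** The recursion combines nonnegative terms only, and nu occurs in denominators only. This takes
    the place of the monotonicity of Bessel zeros in nu. *)
Lemma tcoef_antimono (nu mu : R) (k : nat) : -1 < nu -> nu <= mu -> tcoef mu k <= tcoef nu k.
Proof.
  intros Hnu Hm. induction k as [k IH] using (well_founded_ind Nat.lt_wf_0). destruct k as [|j].
  - rewrite !tcoef_0. apply Rinv_le_contravar; lra.
  - rewrite !tcoef_S. assert (H := pos_INR j). apply Rmult_le_compat.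
    + apply conv_nonneg; intros; apply tcoef_nonneg; lra.
    + left. apply Rinv_0_lt_compat; lra.
    + apply conv_le; intros i Hi; (split; [apply tcoef_nonneg; lra|apply IH; lia]).
    + apply Rinv_le_contravar; lra.
Qed.

Lemma tcoef_riccati (nu : R) (n : nat) : -1 < nu ->
  (INR (S n) + 1 + nu) * tcoef nu (S n) = / 2 * conv (tcoef nu) (tcoef nu) n.
Proof.
  intros Hnu. rewrite tcoef_S, S_INR. assert (H := pos_INR n). field. lra.
Qed.

(** The coefficients of D(w), where J_nu(z) = C z^nu F(z^2) and J_(nu+1)(z) = C z^(nu+1) D(z^2) with
    the same constant C. Also D = -2 F'. *)
Definition dcoef (nu : R) (n : nat) : R := bcoef nu n / (2 * (INR n + 1 + nu)).

Lemma bcoef_S (nu : R) (n : nat) : -1 < nu ->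
  INR (S n) * bcoef nu (S n) = - / 2 * dcoef nu n.
Proof.
  intros Hnu. unfold dcoef. cbn [bcoef]. assert (H := pos_INR n). rewrite S_INR. field. lra.
Qed.

(** This is U F = D, which identifies w U with the Bessel quotient. Multiply the n-th coefficient by
    n + 1 + nu and split n = i + (n - i) as in the Leibniz rule. The Riccati recursion turns one
    part into b_n / 2 plus half the coefficient of w U (U F), the other part is minus half that of w
    U D, and the two cancel since U F = D below n. *)
Lemma conv_tcoef_bcoef (nu : R) (n : nat) : -1 < nu ->
  conv (tcoef nu) (bcoef nu) n = dcoef nu n.
Proof.
  intros Hnu. induction n as [n IH] using (well_founded_ind Nat.lt_wf_0). assert (H := pos_INR n).
  unfold dcoef. apply (Rmult_eq_reg_l (INR n + 1 + nu)); [|lra].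
  replace ((INR n + 1 + nu) * (bcoef nu n / (2 * (INR n + 1 + nu)))) with (/ 2 * bcoef nu n)
    by (field; lra).
  replace ((INR n + 1 + nu) * conv (tcoef nu) (bcoef nu) n) with
    (conv (fun i => (INR i + 1 + nu) * tcoef nu i) (bcoef nu) n
     + conv (tcoef nu) (fun i => INR i * bcoef nu i) n).
  - destruct n as [|m].
    + unfold conv; simpl. rewrite tcoef_0. field. lra.
    + rewrite conv_S, conv_S_r.
      rewrite (conv_ext (fun i => (INR (S i) + 1 + nu) * tcoef nu (S i))
        (fun i => / 2 * conv (tcoef nu) (tcoef nu) i) (bcoef nu) (bcoef nu));
        [|intros; apply tcoef_riccati; trivial|trivial].
      rewrite (conv_ext (tcoef nu) (tcoef nu) (fun i => INR (S i) * bcoef nu (S i))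
         (fun i => - / 2 * dcoef nu i)); [|trivial|intros; apply bcoef_S; trivial].
      rewrite conv_scal_l, conv_scal_r, conv_assoc.
      rewrite (conv_ext (tcoef nu) (tcoef nu) (conv (tcoef nu) (bcoef nu)) (dcoef nu));
        [|trivial|intros; apply IH; lia].
      rewrite tcoef_0. simpl (INR 0). field. lra.
  - unfold conv. rewrite scal_sum, <- sum_plus. apply sum_eq. intros i Hi.
    replace (INR n) with (INR i + INR (n - i)) by (rewrite <- plus_INR; f_equal; lia). ring.
Qed.

Lemma Rabs_bcoef_S (nu : R) (n : nat) : -1 < nu ->
  Rabs (bcoef nu (S n)) = Rabs (bcoef nu n) / (4 * (INR n + 1) * (nu + INR n + 1)).
Proof.
  intros Hnu. assert (H := pos_INR n). cbn [bcoef]. unfold Rdiv.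
  rewrite Rabs_mult, Rabs_Ropp, Rabs_inv, S_INR. do 2 f_equal.
  rewrite Rabs_pos_eq; [ring|]. repeat apply Rmult_le_pos; lra.
Qed.

Lemma Rabs_bcoef_le (nu : R) (n : nat) : -1 < nu ->
  Rabs (bcoef nu n) <= (/ Rmin 1 (1 + nu)) ^ n * / INR (fact n).
Proof.
  (* [c] is a positive lower bound for every factor nu + n + 1; it handles nu near -1. *)
  intros Hnu. set (c := Rmin 1 (1 + nu)).
  assert (Hc : 0 < c) by (apply Rmin_glb_lt; lra).
  assert (C1 : c <= 1) by apply Rmin_l. assert (C2 : c <= 1 + nu) by apply Rmin_r.
  induction n as [|n IH].
  - simpl. rewrite Rabs_R1. lra.
  - rewrite Rabs_bcoef_S by trivial. assert (H := pos_INR n).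
    rewrite fact_simpl, mult_INR, S_INR. simpl pow.
    assert (Hf := INR_fact_lt_0 n).
    replace (/ c * (/ c) ^ n * / ((INR n + 1) * INR (fact n))) with
      ((/ c) ^ n * / INR (fact n) * / ((INR n + 1) * c)) by (field; lra).
    apply Rmult_le_compat; trivial.
    + apply Rabs_pos.
    + left. apply Rinv_0_lt_compat. repeat apply Rmult_lt_0_compat; lra.
    + apply Rinv_le_contravar; [apply Rmult_lt_0_compat; lra|].
      assert (c <= nu + INR n + 1) by lra. nra.
Qed.

Lemma odd_le_pow3 (n : nat) : 2 * INR n + 1 <= 3 ^ n.
Proof.
  induction n as [|n IH]; [simpl; lra|]. rewrite S_INR. simpl. assert (H := pos_INR n). lra.
Qed.

(** The cubic weight covers two derivatives of g_nu together with one more factor n for the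
    Lipschitz bounds. Since (2n+1)^3 <= 27^n, an exponential series dominates. *)
Lemma ex_series_bcoef (nu : R) : -1 < nu ->
  ex_series (fun n => (2 * INR n + 1) ^ 3 * Rabs (bcoef nu n)).
Proof.
  intros Hnu. set (x := / Rmin 1 (1 + nu)).
  apply (ex_series_le_abs _ (fun n => / INR (fact n) * (27 * x) ^ n)).
  - intros n. assert (H := pos_INR n).
    assert (H1 := Rabs_bcoef_le nu n Hnu). fold x in H1.
    assert (H2 : (2 * INR n + 1) ^ 3 <= 27 ^ n).
    { replace 27 with (3 ^ 3) by ring. rewrite <- pow_mult, (Nat.mul_comm 3), pow_mult.
      apply pow_incr. assert (H3 := odd_le_pow3 n). lra. }
    assert (H3 : 0 <= (2 * INR n + 1) ^ 3) by (apply pow_le; lra).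
    rewrite Rabs_pos_eq by (apply Rmult_le_pos; [trivial|apply Rabs_pos]).
    rewrite Rpow_mult_distr.
    replace (/ INR (fact n) * (27 ^ n * x ^ n)) with (27 ^ n * (x ^ n * / INR (fact n))) by ring.
    apply Rmult_le_compat; trivial. apply Rabs_pos.
  - exists (exp (27 * x)). apply is_pseries_R. apply is_exp_Reals.
Qed.

(** * Principal powers *)

(** The functional equation of [Gamma] matches the recursion of [bcoef]; the factor 4^n cancels
    against that of (z/2)^(2n). *)
Lemma Gamma_bcoef (nu : R) (n : nat) : -1 < nu ->
  (-1) ^ n / (INR (fact n) * Gamma (INR n + nu + 1)) = 4 ^ n * bcoef nu n / Gamma (nu + 1).
Proof.
  intros Hnu. assert (Hg := Gamma_pos (nu + 1) ltac:(lra)). induction n as [|n IH].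
  - simpl. replace (0 + nu + 1) with (nu + 1) by ring. field. lra.
  - assert (H := pos_INR n). assert (Hf := INR_fact_lt_0 n).
    assert (Hn := Gamma_pos (INR n + nu + 1) ltac:(lra)).
    replace (INR (S n) + nu + 1) with ((INR n + nu + 1) + 1) by (rewrite S_INR; ring).
    rewrite Gamma_succ, fact_simpl, mult_INR by lra. cbn [bcoef]. rewrite S_INR.
    transitivity ((-1) ^ n / (INR (fact n) * Gamma (INR n + nu + 1))
       * (- / ((INR n + 1) * (INR n + nu + 1)))).
    + simpl. field. lra.
    + rewrite IH. simpl. field. lra.
Qed.

Lemma Carg_polar (z : C) : z <> 0 ->
  (RtoC (Cmod z) * (cos (Carg z), sin (Carg z)))%C = z.
Proof.
  intros Hz. assert (Hp : 0 < Cmod z) by (apply Cmod_gt_0; trivial).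
  assert (H2 := Cmod2_alt z). assert (HR := re_le_Cmod z).
  assert (Hb : -1 <= Re z / Cmod z <= 1).
  { apply Rabs_le_between in HR. split; apply (Rmult_le_reg_r (Cmod z)); trivial;
    unfold Rdiv; rewrite Rmult_assoc, Rinv_l; lra. }
  assert (Hs : sqrt (1 - (Re z / Cmod z)²) = Rabs (Im z) / Cmod z).
  { rewrite <- (sqrt_Rsqr (Rabs (Im z) / Cmod z)).
    - f_equal. unfold Rdiv. rewrite !Rsqr_mult, <- Rsqr_abs.
      apply (Rmult_eq_reg_r (Cmod z ^ 2)); [|apply pow_nonzero; lra].
      unfold Rsqr. field_simplify; [rewrite H2; ring|lra|lra].
    - apply Rdiv_le_0_compat; trivial. apply Rabs_pos. }
  assert (Ez : z = (Re z, Im z)) by apply surjective_pairing.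
  rewrite Ez at 4. unfold Cmult, RtoC; simpl. unfold Carg. destruct (Rle_dec 0 (Im z)) as [Hi|Hi].
  - rewrite cos_acos, sin_acos, Hs, Rabs_pos_eq by trivial.
    f_equal; field; lra.
  - rewrite cos_neg, sin_neg, cos_acos, sin_acos, Hs, Rabs_left by (trivial || lra).
    f_equal; field; lra.
Qed.

Lemma Cpower_nz (z : C) (a : R) : z <> 0 ->
  Cpower z a = (RtoC (Rpower (Cmod z) a) * (cos (a * Carg z), sin (a * Carg z)))%C.
Proof. intros Hz. unfold Cpower. destruct (Ceq_dec z 0); [contradiction|reflexivity]. Qed.

(** Both powers use the same [Carg z], so the exponents add with no branch correction. Hence the
    branch cuts cancel in [bessel_g]. *)
Lemma Cpower_plus (z : C) (a b : R) : z <> 0 ->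
  Cpower z (a + b) = (Cpower z a * Cpower z b)%C.
Proof.
  intros Hz. rewrite !Cpower_nz by trivial.
  rewrite Rpower_plus, Rmult_plus_distr_r, cos_plus, sin_plus.
  unfold Cmult, RtoC; simpl. f_equal; ring.
Qed.

Lemma Cpower_1 (z : C) : z <> 0 -> Cpower z 1 = z.
Proof.
  intros Hz. rewrite Cpower_nz, Rmult_1_l, Rpower_1 by (trivial; apply Cmod_gt_0; trivial).
  apply Carg_polar; trivial.
Qed.

Lemma Cpower_INR (z : C) (n : nat) : z <> 0 -> Cpower z (INR n) = (z ^ n)%C.
Proof.
  intros Hz. induction n as [|n IH].
  - rewrite Cpower_nz by trivial. simpl. rewrite Rmult_0_l, cos_0, sin_0, Rpower_O.
    + unfold Cmult, RtoC; simpl. f_equal; ring.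
    + apply Cmod_gt_0; trivial.
  - rewrite S_INR, Cpower_plus, IH, Cpower_1 by trivial. rewrite Cpow_S. ring.
Qed.

Lemma RtoC_nz (x : R) : x <> 0 -> RtoC x <> 0.
Proof. intros H E. apply H, RtoC_inj, E. Qed.

(** Scaling by a positive number leaves the principal argument unchanged. *)
Lemma Cpower_half (z : C) (a : R) : z <> 0 ->
  Cpower (z / 2)%C a = (RtoC (Rpower 2 (- a)) * Cpower z a)%C.
Proof.
  intros Hz. assert (H2 : RtoC 2 <> 0) by (apply RtoC_nz; lra).
  assert (Hp : 0 < Cmod z) by (apply Cmod_gt_0; trivial).
  assert (Hz2 : (z / 2)%C <> 0).
  { intros E. apply Hz. replace z with (z / 2 * 2)%C by (field; trivial). rewrite E. ring. }
  assert (Em : Cmod (z / 2)%C = Cmod z / 2).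
  { rewrite Cmod_div, Cmod_R, Rabs_pos_eq; trivial; lra. }
  assert (E2 : (z / 2)%C = (Re z / 2, Im z / 2)).
  { destruct z as [x y]. unfold Cdiv, Cinv, Cmult, RtoC, Re, Im; simpl. f_equal; field. }
  assert (Ea : Carg (z / 2)%C = Carg z).
  { unfold Carg. rewrite Em. replace (Re (z / 2)%C) with (Re z / 2) by (rewrite E2; reflexivity).
    replace (Im (z / 2)%C) with (Im z / 2) by (rewrite E2; reflexivity).
    replace (Re z / 2 / (Cmod z / 2)) with (Re z / Cmod z) by (field; lra).
    destruct (Rle_dec 0 (Im z / 2)), (Rle_dec 0 (Im z)); trivial; lra. }
  rewrite !Cpower_nz, Ea, Em by trivial.
  rewrite Cmult_assoc, <- RtoC_mult. do 2 f_equal.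
  unfold Rdiv. rewrite <- Rpower_mult_distr by lra. rewrite Rmult_comm. f_equal.
  unfold Rpower. rewrite ln_Rinv by lra. f_equal. ring.
Qed.

(** * The Bessel series *)

Lemma ex_series_bcoef_le (nu K : R) (c : nat -> R) : -1 < nu ->
  (forall n, Rabs (c n) <= K * ((2 * INR n + 1) ^ 3 * Rabs (bcoef nu n))) ->
  ex_series (fun n => Rabs (c n)).
Proof.
  intros Hnu H. eapply ex_series_Rabs_le; [exact H|].
  apply (ex_series_scal_l (V := R_NormedModule)). apply ex_series_bcoef; trivial.
Qed.

Lemma ex_series_weight_bcoef (nu : R) (q : nat -> R) : -1 < nu ->
  (forall n, 0 <= q n <= 2 * (2 * INR n + 1) ^ 3) ->
  ex_series (fun n => Rabs (q n * bcoef nu n)).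
Proof.
  intros Hnu H. apply (ex_series_bcoef_le nu 2); trivial. intros n. specialize (H n).
  rewrite Rabs_mult, (Rabs_pos_eq (q n)), <- Rmult_assoc by lra.
  apply Rmult_le_compat_r; [apply Rabs_pos|lra].
Qed.

Lemma ex_series_abs_bcoef (nu : R) : -1 < nu -> ex_series (fun n => Rabs (bcoef nu n)).
Proof.
  intros Hnu. apply (ex_series_ext (fun n => Rabs (1 * bcoef nu n))).
  - intros n. rewrite Rmult_1_l. reflexivity.
  - apply ex_series_weight_bcoef; trivial. intros n. assert (H := pos_INR n).
    assert (1 <= (2 * INR n + 1) ^ 3) by (apply pow_R1_Rle; lra). lra.
Qed.

Definition even_exp (n : nat) : nat := (2 * n)%nat.

Lemma BesselJ_Cpser (nu : R) (z : C) : -1 < nu -> z <> 0 -> Cmod z <= 1 ->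
  BesselJ nu z = (RtoC (Rpower 2 (- nu) / Gamma (nu + 1)) * Cpower z nu
                  * Cpser even_exp (bcoef nu) z)%C.
Proof.
  intros Hnu Hz Hz1. unfold BesselJ, Cpser.
  rewrite <- CSeries_scal.
  - apply CSeries_ext. intros n. rewrite Cpower_half by trivial. rewrite Gamma_bcoef by trivial.
    replace (2 * INR n + nu) with (nu + INR (even_exp n))
      by (unfold even_exp; rewrite mult_INR; simpl; ring).
    rewrite Cpower_plus, Cpower_INR by trivial.
    replace (Rpower 2 (- (nu + INR (even_exp n)))) with (Rpower 2 (- nu) / 4 ^ n).
    + assert (Hg := Gamma_pos (nu + 1) ltac:(lra)).
      assert (H4 : 4 ^ n <> 0) by (apply pow_nonzero; lra).
      replace (RtoC (4 ^ n * bcoef nu n / Gamma (nu + 1)))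
        with (RtoC (4 ^ n) * RtoC (bcoef nu n) / RtoC (Gamma (nu + 1)))%C
        by (rewrite <- RtoC_mult, <- RtoC_div; trivial; lra).
      rewrite !RtoC_div by (trivial; lra).
      field. split; apply RtoC_nz; trivial; lra.
    + replace (- (nu + INR (even_exp n))) with (- nu + - INR (even_exp n)) by ring.
      rewrite Rpower_plus, (Rpower_Ropp 2 (INR _)), Rpower_pow by lra.
      unfold even_exp. rewrite pow_mult. replace (2 ^ 2) with 4 by ring. reflexivity.
  - apply Cpser_summable; trivial. apply ex_series_abs_bcoef; trivial.
Qed.

Definition odd_exp (n : nat) : nat := (2 * n + 1)%nat.

Lemma bessel_g_Cpser (nu : R) (z : C) : -1 < nu -> Cmod z <= 1 ->
  bessel_g nu z = Cpser odd_exp (bcoef nu) z.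
Proof.
  intros Hnu Hz1. assert (Hs := ex_series_abs_bcoef nu Hnu).
  assert (E : Cpser odd_exp (bcoef nu) z = (z * Cpser even_exp (bcoef nu) z)%C).
  { unfold Cpser. rewrite <- CSeries_scal by (apply Cpser_summable; trivial).
    apply CSeries_ext. intros n. unfold odd_exp, even_exp. rewrite Cpow_add_r, Cpow_1_r. ring. }
  rewrite E. destruct (Ceq_dec z 0) as [->|Hz].
  - unfold bessel_g. rewrite Cmult_0_l. unfold Cpower at 1.
    destruct (Ceq_dec 0 0) as [_|]; [|contradiction].
    (* For nu <> 1 the prefactor vanishes at 0. For nu = 1 it equals 1, and J_1(0) = 0 is needed
       instead: no exponent 2n + 1 is zero. *)
    destruct (Req_EM_T (1 - nu) 0) as [H|H]; [|ring].
    replace (BesselJ nu 0) with (RtoC 0); [ring|].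
    unfold BesselJ. symmetry. rewrite (CSeries_ext _ (fun n => RtoC (0 * 0))).
    + rewrite CSeries_RtoC, Series_scal_l. f_equal. ring.
    + intros n. rewrite Rmult_0_l. unfold Cpower.
      assert (Z : (0 / 2)%C = 0) by (unfold Cdiv; ring). rewrite Z.
      destruct (Ceq_dec 0 0) as [_|]; [|contradiction].
      destruct (Req_EM_T (2 * INR n + nu) 0) as [H1|_]; [|ring].
      assert (H2 := pos_INR n). lra.
  - unfold bessel_g. rewrite BesselJ_Cpser by trivial.
    assert (Hg := Gamma_pos (nu + 1) ltac:(lra)).
    assert (E1 : (Cpower z (1 - nu) * Cpower z nu)%C = z).
    { rewrite <- Cpower_plus by trivial. replace (1 - nu + nu) with 1 by ring. apply Cpower_1; trivial. }
    transitivity (Cpower z (1 - nu) * Cpower z nu * Cpser even_exp (bcoef nu) z)%C;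
      [|rewrite E1; reflexivity].
    rewrite Rpower_Ropp, RtoC_mult.
    assert (Hp : Rpower 2 nu <> 0) by (apply Rgt_not_eq, exp_pos).
    rewrite RtoC_div by lra. rewrite RtoC_inv by trivial.
    field. split; apply RtoC_nz; trivial; lra.
Qed.

Lemma bcoef_succ (nu : R) (n : nat) : -1 < nu ->
  bcoef (nu + 1) n = 2 * (nu + 1) * dcoef nu n.
Proof.
  intros Hnu. unfold dcoef. induction n as [|n IH].
  - simpl. field. lra.
  - assert (H := pos_INR n). cbn [bcoef]. rewrite IH, S_INR. field. lra.
Qed.

Lemma BesselJ_1 (nu : R) : -1 < nu ->
  BesselJ nu 1 = RtoC (Rpower 2 (- nu) / Gamma (nu + 1) * Series (bcoef nu)).
Proof.
  intros Hnu. rewrite BesselJ_Cpser; trivial; [|apply RtoC_nz; lra|rewrite Cmod_1; lra].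
  assert (E : Cpser even_exp (bcoef nu) 1 = RtoC (Series (bcoef nu))).
  { unfold Cpser. rewrite <- CSeries_RtoC. apply CSeries_ext. intros n. rewrite Cpow_1_l. ring. }
  assert (E1 : Cpower 1 nu = 1).
  { rewrite Cpower_nz by (apply RtoC_nz; lra). unfold Carg. rewrite Cmod_1. simpl.
    replace (1 / 1) with 1 by field. rewrite acos_1.
    destruct (Rle_dec 0 0) as [_|]; [|lra]. rewrite Rmult_0_r, cos_0, sin_0.
    unfold Rpower. rewrite ln_1, Rmult_0_r, exp_0. unfold Cmult, RtoC; simpl. f_equal; ring. }
  rewrite E, E1, RtoC_mult. ring.
Qed.

(** J_nu(1) and J_(nu+1)(1) share the positive factor [k], which leaves a real equation between F(1)
    and D(1). *)
Lemma BesselJ_equation_iff (nu alpha : R) : -1 < nu ->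
  ((RtoC (2 * nu + alpha - 2) * BesselJ (nu + 1) 1 = RtoC alpha * BesselJ nu 1)%C
   <-> (2 * nu + alpha - 2) * Series (dcoef nu) = alpha * Series (bcoef nu)).
Proof.
  intros Hnu. rewrite !BesselJ_1 by lra.
  rewrite (Series_ext (bcoef (nu + 1)) (fun n => 2 * (nu + 1) * dcoef nu n))
    by (intros; apply bcoef_succ; trivial).
  rewrite Series_scal_l, Gamma_succ by lra.
  replace (- (nu + 1)) with (- nu + - (1)) by ring.
  rewrite Rpower_plus, (Rpower_Ropp 2 1), Rpower_1 by lra.
  assert (Hg := Gamma_pos (nu + 1) ltac:(lra)).
  assert (Hp : 0 < Rpower 2 (- nu)) by apply exp_pos.
  set (k := Rpower 2 (- nu) / Gamma (nu + 1)).
  assert (Hk : 0 < k) by (apply Rdiv_lt_0_compat; trivial).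
  replace (Rpower 2 (- nu) * / 2 / ((nu + 1) * Gamma (nu + 1))
            * (2 * (nu + 1) * Series (dcoef nu))) with (k * Series (dcoef nu))
    by (unfold k; field; lra).
  rewrite <- !RtoC_mult. split; intros H.
  - apply RtoC_inj in H. apply (Rmult_eq_reg_l k); lra.
  - f_equal. replace ((2 * nu + alpha - 2) * (k * Series (dcoef nu)))
      with (k * ((2 * nu + alpha - 2) * Series (dcoef nu))) by ring. rewrite H. ring.
Qed.

(** * Power series identities and derivatives *)

Notation Cps := (Cpser (fun n => n)).

Lemma Cpser_ext (e e' : nat -> nat) (c c' : nat -> R) (z : C) :
  (forall n, e n = e' n) -> (forall n, c n = c' n) -> Cpser e c z = Cpser e' c' z.
Proof. intros He Hc. apply CSeries_ext. intros n. rewrite He, Hc. reflexivity. Qed.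

Lemma Cpser_lin (e : nat -> nat) (p q : R) (c c' : nat -> R) (z : C) : Cmod z <= 1 ->
  ex_series (fun n => Rabs (c n)) -> ex_series (fun n => Rabs (c' n)) ->
  Cpser e (fun n => p * c n + q * c' n) z = (RtoC p * Cpser e c z + RtoC q * Cpser e c' z)%C.
Proof.
  intros Hz H H'. assert (S1 := Cpser_summable e c z Hz H). assert (S2 := Cpser_summable e c' z Hz H').
  unfold Cpser. rewrite <- !CSeries_scal by trivial. rewrite <- CSeries_plus.
  - apply CSeries_ext. intros n. rewrite RtoC_plus, !RtoC_mult. ring.
  - apply (Cabs_summable_le _ (fun n => Cmod (RtoC p) * Cmod (c n * z ^ e n)%C)).
    + intros n. rewrite Cmod_mult. lra.
    + apply (ex_series_scal_l (V := R_NormedModule)). exact S1.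
  - apply (Cabs_summable_le _ (fun n => Cmod (RtoC q) * Cmod (c' n * z ^ e n)%C)).
    + intros n. rewrite Cmod_mult. lra.
    + apply (ex_series_scal_l (V := R_NormedModule)). exact S2.
Qed.

Lemma Cps_shift (c c' : nat -> R) (k : R) (z : C) : Cmod z <= 1 ->
  ex_series (fun n => Rabs (c n)) -> ex_series (fun n => Rabs (c' n)) ->
  (forall n, c (S n) = k * c' n) ->
  Cps c z = (RtoC (c 0%nat) + RtoC k * z * Cps c' z)%C.
Proof.
  intros Hz H H' E. assert (S1 := Cpser_summable (fun n => n) c z Hz H).
  assert (S2 := Cpser_summable (fun n => n) c' z Hz H').
  unfold Cpser. rewrite CSeries_incr_1 by trivial. rewrite <- CSeries_scal by trivial.
  f_equal; [simpl; ring|]. apply CSeries_ext. intros n. rewrite E, Cpow_S, RtoC_mult. ring.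
Qed.

Lemma Csum_RtoC_scal (a : nat -> R) (c : C) (n : nat) (u : nat -> C) :
  (forall k, (k <= n)%nat -> u k = (RtoC (a k) * c)%C) ->
  Csum u n = (RtoC (sum_f_R0 a n) * c)%C.
Proof.
  induction n as [|n IH]; intros H; simpl.
  - apply H; lia.
  - rewrite IH by (intros; apply H; lia). rewrite H by lia. rewrite RtoC_plus. ring.
Qed.

Lemma Cps_mult (a b : nat -> R) (z : C) : Cmod z <= 1 ->
  ex_series (fun n => Rabs (a n)) -> ex_series (fun n => Rabs (b n)) ->
  Cps (conv a b) z = (Cps a z * Cps b z)%C.
Proof.
  intros Hz Ha Hb. unfold Cpser. rewrite <- CSeries_mult by (apply (Cpser_summable (fun n => n)); trivial).
  apply CSeries_ext. intros n. symmetry. apply Csum_RtoC_scal. intros k Hk.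
  replace (z ^ n)%C with (z ^ k * z ^ (n - k))%C by (rewrite <- Cpow_add_r; f_equal; lia).
  rewrite RtoC_mult. ring.
Qed.

Lemma Cps_1 (c : nat -> R) : Cps c 1 = RtoC (Series c).
Proof.
  unfold Cpser. rewrite <- CSeries_RtoC. apply CSeries_ext. intros n. rewrite Cpow_1_l. ring.
Qed.

Lemma Cpser_even_exp (c : nat -> R) (z : C) : Cpser even_exp c z = Cps c (z ^ 2)%C.
Proof. apply CSeries_ext. intros n. unfold even_exp. rewrite Cpow_mult_r. reflexivity. Qed.

(** With w = z^2, [pcoef] gives the series of g' and [kcoef] that of (z g')' = g' + z g''. The
    weights come from differentiating z^(2n+1) once, and again after multiplication by z. *)
Definition pcoef (nu : R) (n : nat) : R := (2 * INR n + 1) * bcoef nu n.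
Definition kcoef (nu : R) (n : nat) : R := (2 * INR n + 1) ^ 2 * bcoef nu n.

Lemma ex_series_abs_pcoef (nu : R) : -1 < nu -> ex_series (fun n => Rabs (pcoef nu n)).
Proof.
  intros Hnu. apply ex_series_weight_bcoef; trivial. intros n. assert (H := pos_INR n).
  nra.
Qed.

Lemma ex_series_abs_kcoef (nu : R) : -1 < nu -> ex_series (fun n => Rabs (kcoef nu n)).
Proof.
  intros Hnu. apply ex_series_weight_bcoef; trivial. intros n. assert (H := pos_INR n).
  nra.
Qed.

Lemma dcoef_eq (nu : R) (n : nat) : -1 < nu -> dcoef nu n = - 2 * (INR (S n) * bcoef nu (S n)).
Proof. intros Hnu. rewrite bcoef_S by trivial. field. Qed.

Lemma ex_series_abs_nbcoef (nu : R) : -1 < nu -> ex_series (fun n => Rabs (INR n * bcoef nu n)).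
Proof.
  intros Hnu. apply ex_series_weight_bcoef; trivial. intros n. assert (H := pos_INR n).
  nra.
Qed.

Lemma ex_series_abs_dcoef (nu : R) : -1 < nu -> ex_series (fun n => Rabs (dcoef nu n)).
Proof.
  intros Hnu. assert (H := ex_series_abs_nbcoef nu Hnu).
  apply ex_series_incr_1 in H. apply (ex_series_scal_l (V := R_NormedModule) 2) in H.
  eapply ex_series_ext; [|exact H]. intros n.
  rewrite dcoef_eq, (Rabs_mult (-2)) by trivial. rewrite (Rabs_left (-2)) by lra.
  unfold scal; simpl; unfold mult; simpl. ring.
Qed.

Lemma Cps_nbcoef (nu : R) (w : C) : -1 < nu -> Cmod w <= 1 ->
  Cps (fun n => INR n * bcoef nu n) w = (- (w / 2) * Cps (dcoef nu) w)%C.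
Proof.
  intros Hnu Hw. rewrite (Cps_shift _ (dcoef nu) (- / 2)); trivial.
  - simpl. rewrite Rmult_0_l, RtoC_opp, RtoC_inv by lra. unfold Cdiv. ring.
  - apply ex_series_abs_nbcoef; trivial.
  - apply ex_series_abs_dcoef; trivial.
  - intros n. apply bcoef_S; trivial.
Qed.

Lemma Cps_pcoef (nu : R) (w : C) : -1 < nu -> Cmod w <= 1 ->
  Cps (pcoef nu) w = (Cps (bcoef nu) w - w * Cps (dcoef nu) w)%C.
Proof.
  intros Hnu Hw.
  rewrite (Cpser_ext _ (fun n => n) _ (fun n => 1 * bcoef nu n + 2 * (INR n * bcoef nu n)));
    [|reflexivity|intros n; unfold pcoef; ring].
  rewrite Cpser_lin, Cps_nbcoef; trivial.
  - field.
  - apply ex_series_abs_bcoef; trivial.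
  - apply ex_series_abs_nbcoef; trivial.
Qed.

(** Expand (2n+1)^2 = 1 + 4 (1 - nu) n + 4 n (n + nu). The last part, [r], is a shift of -b by the
    differential equation 4 n (n + nu) b_n = -b_(n-1), and the middle one is a multiple of w D. At w
    = 1 the F term drops out, which explains the simple form of the equation for the root. *)
Lemma Cps_kcoef (nu : R) (w : C) : -1 < nu -> Cmod w <= 1 ->
  Cps (kcoef nu) w =
  ((1 - w) * Cps (bcoef nu) w - RtoC (2 * (1 - nu)) * w * Cps (dcoef nu) w)%C.
Proof.
  intros Hnu Hw.
  set (r := fun n => 4 * (INR n * (INR n + nu)) * bcoef nu n).
  assert (Hb := ex_series_abs_bcoef nu Hnu). assert (Hn := ex_series_abs_nbcoef nu Hnu).
  assert (Hr : ex_series (fun n => Rabs (r n))).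
  { apply (ex_series_bcoef_le nu (4 * (1 + Rabs nu))); trivial. intros n.
    unfold r. rewrite (Rabs_mult _ (bcoef nu n)), <- (Rmult_assoc (4 * (1 + Rabs nu))).
    apply Rmult_le_compat_r; [apply Rabs_pos|].
    assert (H := pos_INR n). assert (A := Rabs_pos nu).
    assert (A1 : Rabs (INR n + nu) <= INR n + Rabs nu).
    { eapply Rle_trans; [apply Rabs_triang|]. rewrite (Rabs_pos_eq (INR n)); lra. }
    rewrite !Rabs_mult, (Rabs_pos_eq 4), (Rabs_pos_eq (INR n)) by lra.
    assert (INR n * Rabs (INR n + nu) <= INR n * (INR n + Rabs nu))
      by (apply Rmult_le_compat_l; trivial).
    assert (INR n * (INR n + Rabs nu) <= (1 + Rabs nu) * (2 * INR n + 1) ^ 3).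
    { assert (INR n * INR n <= (2 * INR n + 1) ^ 3) by nra.
      assert (INR n <= (2 * INR n + 1) ^ 3) by nra. nra. }
    lra. }
  rewrite (Cpser_ext _ (fun n => n) _ (fun n => 1 * (1 * bcoef nu n
      + 4 * (1 - nu) * (INR n * bcoef nu n)) + 1 * r n));
    [|reflexivity|intros n; unfold kcoef, r; ring].
  rewrite Cpser_lin, Cpser_lin, Cps_nbcoef; trivial.
  - rewrite (Cps_shift r (bcoef nu) (- (1))); trivial.
    + unfold r. simpl INR. replace (4 * (0 * (0 + nu)) * bcoef nu 0) with 0 by ring.
      rewrite !RtoC_mult, RtoC_opp. field.
    + intros n. unfold r.
      replace (4 * (INR (S n) * (INR (S n) + nu)) * bcoef nu (S n))
        with (4 * (INR (S n) + nu) * (INR (S n) * bcoef nu (S n))) by ring.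
      rewrite bcoef_S, S_INR by trivial. unfold dcoef. assert (H := pos_INR n). field. lra.
  - apply (ex_series_Rabs_le _ (fun n => Rabs (bcoef nu n) + Rabs (4 * (1 - nu)) * Rabs (INR n * bcoef nu n))).
    + intros n. eapply Rle_trans; [apply Rabs_triang|]. rewrite Rmult_1_l, Rabs_mult. lra.
    + apply (ex_series_plus (V := R_NormedModule)); trivial.
      apply (ex_series_scal_l (V := R_NormedModule)); trivial.
Qed.

(** * The first two derivatives of g_nu *)

Lemma locally_disk (z : C) : in_unit_disk z ->
  locally (T := AbsRing_UniformSpace C_AbsRing) z in_unit_disk.
Proof.
  unfold in_unit_disk. intros Hz. assert (H : 0 < 1 - Cmod z) by lra.
  exists (mkposreal _ H). intros w Hw. change (Cmod (w - z)%C < 1 - Cmod z) in Hw.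
  replace w with ((w - z) + z)%C by ring. eapply Rle_lt_trans; [apply Cmod_triangle|]. lra.
Qed.

Lemma INR_odd_exp (n : nat) : INR (odd_exp n) = 2 * INR n + 1.
Proof. unfold odd_exp. rewrite plus_INR, mult_INR. simpl. ring. Qed.

Lemma INR_even_exp (n : nat) : INR (even_exp n) = 2 * INR n.
Proof. unfold even_exp. rewrite mult_INR. simpl. ring. Qed.

Lemma is_C_derive_bessel_g (nu : R) (z : C) : -1 < nu -> in_unit_disk z ->
  is_derive (K := C_AbsRing) (V := C_NormedModule) (bessel_g nu) z (Cpser even_exp (pcoef nu) z).
Proof.
  intros Hnu Hz. apply (is_derive_ext_loc (K := C_AbsRing) (V := C_NormedModule) (Cpser odd_exp (bcoef nu))).
  - generalize (locally_disk z Hz). apply filter_imp. intros w Hw. symmetry.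
    apply bessel_g_Cpser; trivial. unfold in_unit_disk in Hw; lra.
  - rewrite (Cpser_ext even_exp (fun n => pred (odd_exp n)) (pcoef nu)
       (fun n => INR (odd_exp n) * bcoef nu n)).
    + assert (W : forall k, (k <= 2)%nat ->
         ex_series (fun n => INR (odd_exp n) ^ k * Rabs (bcoef nu n))).
      { intros k Hk. eapply ex_series_ext;
          [|apply (ex_series_weight_bcoef nu (fun n => (2 * INR n + 1) ^ k) Hnu)].
        - intros n. assert (H := pos_INR n). cbv beta.
          rewrite INR_odd_exp, Rabs_mult, Rabs_pos_eq; trivial. apply pow_le; lra.
        - intros n. assert (H := pos_INR n). split; [apply pow_le; lra|].
          assert (1 <= (2 * INR n + 1) ^ 3) by (apply pow_R1_Rle; lra).
          assert ((2 * INR n + 1) ^ k <= (2 * INR n + 1) ^ 3) by (apply Rle_pow; [lra|lia]). lra. }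
      apply is_C_derive_Cpser; trivial.
      * apply ex_series_abs_bcoef; trivial.
      * eapply ex_series_ext; [|apply (W 1%nat); lia]. intros n. cbv beta. rewrite pow_1. reflexivity.
      * apply (W 2%nat); lia.
    + intros n. unfold even_exp, odd_exp. lia.
    + intros n. rewrite INR_odd_exp. reflexivity.
Qed.

Lemma C_derive_bessel_g (nu : R) (z : C) : -1 < nu -> in_unit_disk z ->
  C_derive (bessel_g nu) z = Cps (pcoef nu) (z ^ 2)%C.
Proof.
  intros Hnu Hz. rewrite <- Cpser_even_exp. apply is_C_derive_unique, is_C_derive_bessel_g; trivial.
Qed.

Lemma C_derive2_bessel_g (nu : R) (z : C) : -1 < nu -> in_unit_disk z ->
  (C_derive (bessel_g nu) z + z * C_derive (C_derive (bessel_g nu)) z)%C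
  = Cps (kcoef nu) (z ^ 2)%C.
Proof.
  intros Hnu Hz. assert (Hz1 : Cmod z <= 1) by (unfold in_unit_disk in Hz; lra).
  assert (W : forall k, (k <= 2)%nat ->
     ex_series (fun n => INR (even_exp n) ^ k * Rabs (pcoef nu n))).
  { intros k Hk. eapply ex_series_ext;
      [|apply (ex_series_weight_bcoef nu (fun n => (2 * INR n) ^ k * (2 * INR n + 1)) Hnu)].
    - intros n. assert (H := pos_INR n). cbv beta. unfold pcoef.
      rewrite INR_even_exp, Rmult_assoc, (Rabs_mult ((2 * INR n) ^ k)), (Rabs_pos_eq ((2 * INR n) ^ k));
        [reflexivity|]. apply pow_le; lra.
    - intros n. assert (H := pos_INR n).
      assert (0 <= (2 * INR n) ^ k) by (apply pow_le; lra). split; [apply Rmult_le_pos; lra|].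
      assert ((2 * INR n) ^ k <= (2 * INR n + 1) ^ k) by (apply pow_incr; lra).
      assert ((2 * INR n + 1) ^ k <= (2 * INR n + 1) ^ 2) by (apply Rle_pow; [lra|lia]).
      assert (0 <= (2 * INR n + 1) ^ 3) by (apply pow_le; lra).
      assert ((2 * INR n) ^ k * (2 * INR n + 1) <= (2 * INR n + 1) ^ 2 * (2 * INR n + 1))
        by (apply Rmult_le_compat_r; lra).
      simpl in *. lra. }
  assert (W1 : ex_series (fun n => INR (even_exp n) * Rabs (pcoef nu n))).
  { eapply ex_series_ext; [|apply (W 1%nat); lia]. intros n. cbv beta. rewrite pow_1. reflexivity. }
  assert (E : C_derive (C_derive (bessel_g nu)) z =
      Cpser (fun n => pred (even_exp n)) (fun n => INR (even_exp n) * pcoef nu n) z).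
  { apply is_C_derive_unique.
    apply (is_derive_ext_loc (K := C_AbsRing) (V := C_NormedModule) (Cpser even_exp (pcoef nu))).
    - generalize (locally_disk z Hz). apply filter_imp. intros w Hw. symmetry.
      apply is_C_derive_unique, is_C_derive_bessel_g; trivial.
    - apply is_C_derive_Cpser; trivial.
      + apply ex_series_abs_pcoef; trivial.
      + apply (W 2%nat); lia. }
  assert (A : ex_series (fun n => Rabs (INR (even_exp n) * pcoef nu n))).
  { eapply ex_series_ext; [|exact W1]. intros n. cbv beta.
    rewrite Rabs_mult, (Rabs_pos_eq (INR _)); trivial. apply pos_INR. }
  assert (E2 : (z * C_derive (C_derive (bessel_g nu)) z)%C
       = Cps (fun n => INR (even_exp n) * pcoef nu n) (z ^ 2)%C).
  { rewrite E, <- Cpser_even_exp. unfold Cpser. rewrite <- CSeries_scal.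
    - apply CSeries_ext. intros n. destruct n as [|n].
      + replace (INR (even_exp 0) * pcoef nu 0) with 0 by (simpl; ring). ring.
      + replace (even_exp (S n)) with (S (S (even_exp n))) by (unfold even_exp; lia).
        cbn [pred]. rewrite (Cpow_S z (S (even_exp n))). ring.
    - apply Cpser_summable; trivial. }
  rewrite E2, C_derive_bessel_g by trivial.
  assert (Hz2 : Cmod (z ^ 2)%C <= 1) by (apply Cmod_pow_le_1; trivial).
  rewrite (Cpser_ext _ (fun n => n) (kcoef nu)
     (fun n => 1 * pcoef nu n + 1 * (INR (even_exp n) * pcoef nu n))).
  - rewrite Cpser_lin; trivial; [ring|]. apply ex_series_abs_pcoef; trivial.
  - reflexivity.
  - intros n. rewrite INR_even_exp. unfold kcoef, pcoef. ring.
Qed.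

(** * Sufficiency *)

Lemma Series_geom_scal (k q : R) : Rabs q < 1 -> Series (fun n => k * q ^ n) = k / (1 - q).
Proof. intros Hq. rewrite Series_scal_l, Series_geom by trivial. reflexivity. Qed.

Lemma ex_series_geom_scal (k q : R) : Rabs q < 1 -> ex_series (fun n => k * q ^ n).
Proof.
  intros Hq. apply (ex_series_scal_l (V := R_NormedModule)). apply ex_series_geom; trivial.
Qed.

Lemma tcoef_le_geom (nu : R) (k : nat) : 0 <= nu -> tcoef nu k <= / 2 * (/ 4) ^ k.
Proof.
  intros Hnu. eapply Rle_trans; [apply tcoef_le; lra|].
  replace (/ 2 * (/ 4) ^ k) with (2 * (/ 4) ^ S k) by (simpl; field).
  apply Rmult_le_compat_l; [lra|]. apply pow_incr. split.
  - left. apply Rinv_0_lt_compat; lra.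
  - apply Rinv_le_contravar; lra.
Qed.

Definition ycoef (nu : R) (k : nat) : R := (INR k + 1) * tcoef nu k.

Lemma INR_lt_pow2 (n : nat) : INR n + 1 <= 2 ^ n.
Proof.
  induction n as [|n IH]; [simpl; lra|]. rewrite S_INR. simpl. assert (H := pos_INR n). lra.
Qed.

Lemma ycoef_nonneg (nu : R) (k : nat) : 0 <= nu -> 0 <= ycoef nu k.
Proof.
  intros Hnu. assert (H := pos_INR k). apply Rmult_le_pos; [lra|apply tcoef_nonneg; lra].
Qed.

Lemma ycoef_le_geom (nu : R) (k : nat) : 0 <= nu -> ycoef nu k <= / 2 * (/ 2) ^ k.
Proof.
  intros Hnu. unfold ycoef. assert (H := pos_INR k).
  replace (/ 2 * (/ 2) ^ k) with (2 ^ k * (/ 2 * (/ 4) ^ k)).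
  - apply Rmult_le_compat; [lra|apply tcoef_nonneg; lra|apply INR_lt_pow2|apply tcoef_le_geom; trivial].
  - replace (/ 4) with (/ 2 * / 2) by field. rewrite Rpow_mult_distr.
    replace (2 ^ k * (/ 2 * ((/ 2) ^ k * (/ 2) ^ k))) with (/ 2 * (/ 2) ^ k * (2 ^ k * (/ 2) ^ k)) by ring.
    rewrite <- Rpow_mult_distr, Rinv_r, pow1 by lra. ring.
Qed.

Lemma ex_series_abs_tcoef (nu : R) : 0 <= nu -> ex_series (fun n => Rabs (tcoef nu n)).
Proof.
  intros Hnu. apply (ex_series_Rabs_le _ (fun k => / 2 * (/ 4) ^ k)).
  - intros n. rewrite Rabs_pos_eq; [apply tcoef_le_geom; trivial|apply tcoef_nonneg; lra].
  - apply ex_series_geom_scal. rewrite Rabs_pos_eq; lra.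
Qed.

Lemma ex_series_abs_ycoef (nu : R) : 0 <= nu -> ex_series (fun n => Rabs (ycoef nu n)).
Proof.
  intros Hnu. apply (ex_series_Rabs_le _ (fun k => / 2 * (/ 2) ^ k)).
  - intros n. rewrite Rabs_pos_eq; [apply ycoef_le_geom; trivial|apply ycoef_nonneg; lra].
  - apply ex_series_geom_scal. rewrite Rabs_pos_eq; lra.
Qed.

Definition uval (nu : R) : R := Series (tcoef nu).
Definition yval (nu : R) : R := Series (ycoef nu).

Lemma uval_le (nu : R) : 0 <= nu -> uval nu <= 2 / 3.
Proof.
  intros Hnu. assert (H4 : Rabs (/ 4) < 1) by (rewrite Rabs_pos_eq; lra).
  replace (2 / 3) with (/ 2 / (1 - / 4)) by field. rewrite <- Series_geom_scal by trivial.
  apply Series_le; [|apply ex_series_geom_scal; trivial].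
  intros n. split; [apply tcoef_nonneg; lra|apply tcoef_le_geom; trivial].
Qed.

Lemma uval_ge (nu : R) : 0 <= nu -> / (2 * (1 + nu)) <= uval nu.
Proof.
  intros Hnu. assert (H := ex_series_abs_tcoef nu Hnu). unfold uval.
  rewrite Series_incr_1 by (apply ex_series_Rabs; trivial). rewrite tcoef_0.
  assert (0 <= Series (fun k => tcoef nu (S k))); [|lra].
  rewrite <- (Rmult_0_l (Series (fun k => tcoef nu (S k)))) , <- Series_scal_l.
  apply Series_le.
  - intros n. rewrite Rmult_0_l. split; [lra|apply tcoef_nonneg; lra].
  - apply ex_series_Rabs in H. apply ex_series_incr_1 in H. exact H.
Qed.

Lemma uval_pos (nu : R) : 0 <= nu -> 0 < uval nu.
Proof.
  intros Hnu. eapply Rlt_le_trans; [|apply uval_ge; trivial]. apply Rinv_0_lt_compat; lra.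
Qed.

Lemma uval_decreasing (nu mu : R) : 0 <= nu -> nu < mu -> uval mu < uval nu.
Proof.
  intros Hnu Hm. unfold uval.
  assert (H1 := ex_series_Rabs _ (ex_series_abs_tcoef nu Hnu)).
  assert (H2 := ex_series_Rabs _ (ex_series_abs_tcoef mu ltac:(lra))).
  rewrite (Series_incr_1 _ H1), (Series_incr_1 _ H2), !tcoef_0.
  apply Rplus_lt_le_compat; [apply Rinv_lt_contravar; nra|].
  apply Series_le.
  - intros n. split; [apply tcoef_nonneg|apply tcoef_antimono]; lra.
  - apply ex_series_incr_1 in H1. exact H1.
Qed.

Lemma yval_antimono (nu mu : R) : 0 <= nu -> nu <= mu -> yval mu <= yval nu.
Proof.
  intros Hnu Hm. apply Series_le; [|apply ex_series_Rabs, ex_series_abs_ycoef; trivial].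
  intros n. split; [apply ycoef_nonneg; lra|]. unfold ycoef. assert (H := pos_INR n).
  apply Rmult_le_compat_l; [lra|]. apply tcoef_antimono; lra.
Qed.

Lemma yval_nonneg (nu : R) : 0 <= nu -> 0 <= yval nu.
Proof.
  intros Hnu. unfold yval. rewrite <- (Rmult_0_l (Series (ycoef nu))), <- Series_scal_l.
  apply Series_le; [|apply ex_series_Rabs, ex_series_abs_ycoef; trivial].
  intros n. rewrite Rmult_0_l. split; [lra|apply ycoef_nonneg; trivial].
Qed.

Lemma riccati (nu : R) (w : C) : 0 <= nu -> Cmod w <= 1 ->
  (Cps (ycoef nu) w + RtoC nu * Cps (tcoef nu) w)%C
  = (/ 2 + / 2 * w * (Cps (tcoef nu) w * Cps (tcoef nu) w))%C.
Proof.
  intros Hnu Hw. assert (Ht := ex_series_abs_tcoef nu Hnu). assert (Hy := ex_series_abs_ycoef nu Hnu).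
  rewrite <- Cps_mult by trivial.
  set (c := fun n => 1 * ycoef nu n + nu * tcoef nu n).
  assert (Hc : ex_series (fun n => Rabs (c n))).
  { apply (ex_series_Rabs_le _ (fun n => Rabs (ycoef nu n) + nu * Rabs (tcoef nu n))).
    - intros n. unfold c. eapply Rle_trans; [apply Rabs_triang|].
      rewrite Rmult_1_l, Rabs_mult, (Rabs_pos_eq nu); lra.
    - apply (ex_series_plus (V := R_NormedModule)); trivial.
      apply (ex_series_scal_l (V := R_NormedModule)); trivial. }
  assert (E : forall n, c (S n) = / 2 * conv (tcoef nu) (tcoef nu) n).
  { intros n. rewrite <- tcoef_riccati by lra. unfold c, ycoef. ring. }
  transitivity (Cps c w).
  - unfold c. rewrite Cpser_lin by trivial. ring.
  - rewrite (Cps_shift c (conv (tcoef nu) (tcoef nu)) (/ 2)); trivial.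
    + unfold c, ycoef. rewrite tcoef_0. simpl INR.
      replace (1 * ((0 + 1) * / (2 * (1 + nu))) + nu * / (2 * (1 + nu))) with (/ 2) by (field; lra).
      rewrite RtoC_inv by lra. reflexivity.
    + apply (ex_series_Rabs_le _ (fun n => 2 * Rabs (c (S n)))).
      * intros n. rewrite E, Rabs_mult, (Rabs_pos_eq (/ 2)); lra.
      * apply (ex_series_scal_l (V := R_NormedModule)). apply ex_series_incr_1 in Hc. exact Hc.
Qed.

Lemma Cps_dcoef (nu : R) (w : C) : 0 <= nu -> Cmod w <= 1 ->
  Cps (dcoef nu) w = (Cps (tcoef nu) w * Cps (bcoef nu) w)%C.
Proof.
  intros Hnu Hw. rewrite <- Cps_mult; trivial.
  - apply Cpser_ext; trivial. intros n. symmetry. apply conv_tcoef_bcoef. lra.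
  - apply ex_series_abs_tcoef; trivial.
  - apply ex_series_abs_bcoef; lra.
Qed.

Lemma Cps_pcoef_factor (nu : R) (w : C) : 0 <= nu -> Cmod w <= 1 ->
  Cps (pcoef nu) w = (Cps (bcoef nu) w * (1 - w * Cps (tcoef nu) w))%C.
Proof. intros Hnu Hw. rewrite Cps_pcoef, Cps_dcoef by (trivial || lra). ring. Qed.

Lemma Cps_kcoef_factor (nu : R) (w : C) : 0 <= nu -> Cmod w <= 1 ->
  Cps (kcoef nu) w = (Cps (bcoef nu) w *
    ((1 - w * Cps (tcoef nu) w) * (1 - w * Cps (tcoef nu) w) - 2 * w * Cps (ycoef nu) w))%C.
Proof.
  intros Hnu Hw. rewrite Cps_kcoef, Cps_dcoef by (trivial || lra).
  assert (R := riccati nu w Hnu Hw).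
  set (U := Cps (tcoef nu) w) in *. set (Y := Cps (ycoef nu) w) in *.
  assert (E : Y = (/ 2 + / 2 * w * (U * U) - RtoC nu * U)%C) by (rewrite <- R; ring).
  rewrite E, RtoC_mult, RtoC_minus. field.
Qed.

Definition convexity_order (nu : R) : R := 1 - uval nu - 2 * yval nu / (1 - uval nu).

Lemma yval_eq (nu : R) : 0 <= nu -> yval nu = / 2 + / 2 * uval nu ^ 2 - nu * uval nu.
Proof.
  intros Hnu. assert (R := riccati nu 1 Hnu ltac:(rewrite Cmod_1; lra)).
  rewrite !Cps_1 in R. fold (uval nu) (yval nu) in R.
  apply (f_equal Re) in R. unfold Cinv, Cmult, Cplus, RtoC, Re in R. simpl in R. field_simplify in R.
  lra.
Qed.

Lemma convexity_order_eq (nu : R) : 0 <= nu ->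
  convexity_order nu = (2 * nu - 2) * uval nu / (1 - uval nu).
Proof.
  intros Hnu. unfold convexity_order. rewrite yval_eq by trivial.
  assert (H := uval_le nu Hnu). field. lra.
Qed.

Lemma convexity_order_increasing (nu mu : R) : 0 <= nu -> nu < mu ->
  convexity_order nu < convexity_order mu.
Proof.
  intros Hnu Hm. unfold convexity_order.
  assert (H1 := uval_decreasing nu mu Hnu Hm). assert (H2 := yval_antimono nu mu Hnu ltac:(lra)).
  assert (H3 := uval_le nu Hnu). assert (H4 := yval_nonneg mu ltac:(lra)).
  assert (2 * yval mu / (1 - uval mu) <= 2 * yval nu / (1 - uval nu)); [|lra].
  apply Rmult_le_compat; try lra.
  - left. apply Rinv_0_lt_compat; lra.
  - apply Rinv_le_contravar; lra.
Qed.

Lemma Rabs_pcoef_S (nu : R) (n : nat) : 0 <= nu -> Rabs (pcoef nu (S n)) <= 3 / 4 * (/ 8) ^ n.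
Proof.
  intros Hnu.
  assert (E : forall m, Rabs (pcoef nu m) = (2 * INR m + 1) * Rabs (bcoef nu m)).
  { intros m. unfold pcoef. rewrite Rabs_mult, Rabs_pos_eq; trivial.
    assert (H := pos_INR m). lra. }
  induction n as [|n IH].
  - rewrite E, Rabs_bcoef_S by lra. simpl. rewrite Rabs_R1.
    replace ((2 * 1 + 1) * (1 / (4 * (0 + 1) * (nu + 0 + 1)))) with (3 / 4 * / (nu + 1)) by (field; lra).
    assert (/ (nu + 1) <= 1) by (rewrite <- Rinv_1; apply Rinv_le_contravar; lra). lra.
  - rewrite E, Rabs_bcoef_S by lra. rewrite E in IH. assert (H := pos_INR n).
    assert (H1 := Rabs_pos (bcoef nu (S n))). rewrite !S_INR in *.
    set (x := Rabs (bcoef nu (S n))) in *. simpl pow.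
    apply Rle_trans with (/ 8 * ((2 * (INR n + 1) + 1) * x)); [|lra].
    assert (D : 0 < 4 * (INR n + 1 + 1) * (nu + (INR n + 1) + 1)) by (apply Rmult_lt_0_compat; lra).
    apply (Rmult_le_reg_r (4 * (INR n + 1 + 1) * (nu + (INR n + 1) + 1))); trivial.
    replace ((2 * (INR n + 1 + 1) + 1) * (x / (4 * (INR n + 1 + 1) * (nu + (INR n + 1) + 1)))
      * (4 * (INR n + 1 + 1) * (nu + (INR n + 1) + 1))) with ((2 * (INR n + 1 + 1) + 1) * x)
      by (field; lra).
    replace (/ 8 * ((2 * (INR n + 1) + 1) * x) * (4 * (INR n + 1 + 1) * (nu + (INR n + 1) + 1)))
      with (/ 2 * ((2 * (INR n + 1) + 1) * (INR n + 1 + 1) * (nu + (INR n + 1) + 1)) * x) by field.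
    apply Rmult_le_compat_r; trivial.
    assert ((2 * (INR n + 1) + 1) * (INR n + 1 + 1) * (0 + (INR n + 1) + 1)
      <= (2 * (INR n + 1) + 1) * (INR n + 1 + 1) * (nu + (INR n + 1) + 1))
      by (apply Rmult_le_compat_l; nra).
    nra.
Qed.

Lemma Series_abs_pcoef_S (nu : R) : 0 <= nu ->
  ex_series (fun n => Rabs (pcoef nu (S n))) /\ Series (fun n => Rabs (pcoef nu (S n))) < 1.
Proof.
  intros Hnu. assert (H8 : Rabs (/ 8) < 1) by (rewrite Rabs_pos_eq; lra). split.
  - apply (ex_series_Rabs_le _ (fun n => 3 / 4 * (/ 8) ^ n)).
    + intros n. apply Rabs_pcoef_S; trivial.
    + apply ex_series_geom_scal; trivial.
  - apply Rle_lt_trans with (3 / 4 / (1 - / 8)); [|lra].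
    rewrite <- Series_geom_scal by trivial.
    apply Series_le; [|apply ex_series_geom_scal; trivial].
    intros n. split; [apply Rabs_pos|apply Rabs_pcoef_S; trivial].
Qed.

Lemma Cmod_Cps_pcoef_minus_1 (nu : R) (w : C) : 0 <= nu -> Cmod w <= 1 ->
  Cmod (Cps (pcoef nu) w - 1)%C < 1.
Proof.
  intros Hnu Hw. destruct (Series_abs_pcoef_S nu Hnu) as [H1 H2].
  rewrite (Cps_shift (pcoef nu) (fun n => pcoef nu (S n)) 1); trivial.
  - replace (pcoef nu 0) with 1 by (unfold pcoef; simpl; ring).
    replace (1 + 1 * w * Cps (fun n => pcoef nu (S n)) w - 1)%C
      with (w * Cps (fun n => pcoef nu (S n)) w)%C by ring.
    rewrite Cmod_mult. assert (H3 := Cmod_Cpser_le (fun n => n) _ w Hw H1).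
    assert (H4 := Cmod_ge_0 w). assert (H5 := Cmod_ge_0 (Cps (fun n => pcoef nu (S n)) w)). nra.
  - apply ex_series_abs_pcoef; lra.
  - intros n. ring.
Qed.

Lemma Cps_pcoef_nz (nu : R) (w : C) : 0 <= nu -> Cmod w <= 1 -> Cps (pcoef nu) w <> 0.
Proof.
  intros Hnu Hw E. assert (H := Cmod_Cps_pcoef_minus_1 nu w Hnu Hw). rewrite E in H.
  replace (0 - 1)%C with (- (1))%C in H by ring. rewrite Cmod_m1 in H. lra.
Qed.

(* [|g z - g w - (z - w)| < |z - w|] for [z <> w], a discrete form of [Re g' > 0]. *)
Lemma univalent_bessel_g (nu : R) : 0 <= nu -> univalent_in_disk (bessel_g nu).
Proof.
  intros Hnu z w Hz Hw. unfold in_unit_disk in *.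
  rewrite !bessel_g_Cpser by lra. intros E.
  assert (Hs := ex_series_abs_bcoef nu ltac:(lra)).
  assert (Sp : forall v, Cmod v <= 1 -> Cpser odd_exp (bcoef nu) v =
     (v + Cpser (fun n => odd_exp (S n)) (fun n => bcoef nu (S n)) v)%C).
  { intros v Hv. unfold Cpser. rewrite CSeries_incr_1.
    - f_equal. simpl. ring.
    - apply Cpser_summable; trivial. }
  rewrite !Sp in E by lra.
  destruct (Series_abs_pcoef_S nu Hnu) as [H1 H2].
  assert (Q : forall n, Rabs (pcoef nu (S n))
     = INR (odd_exp (S n)) * Rabs (bcoef nu (S n))).
  { intros n. unfold pcoef. rewrite INR_odd_exp, Rabs_mult, Rabs_pos_eq; trivial.
    assert (H := pos_INR (S n)). lra. }
  assert (L := Cpser_Lipschitz (fun n => odd_exp (S n))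
     (fun n => bcoef nu (S n)) z w ltac:(lra) ltac:(lra)).
  assert (Hs1 := Hs). apply ex_series_incr_1 in Hs1. specialize (L Hs1).
  assert (H3 := ex_series_ext _ _ Q H1). specialize (L H3).
  cbv beta in L. rewrite <- (Series_ext _ _ Q) in L.
  set (g1 := Cpser _ _ z) in *. set (g2 := Cpser _ _ w) in *.
  replace (g1 - g2)%C with (- (z - w))%C in L.
  - rewrite Cmod_opp in L. assert (H := Cmod_ge_0 (z - w)%C).
    assert (Z : Cmod (z - w)%C = 0) by nra.
    apply Cmod_eq_0 in Z. replace z with (z - w + w)%C by ring. rewrite Z. ring.
  - replace g1 with (z + g1 - z)%C by ring. rewrite E. ring.
Qed.

Lemma Re_kcoef_div_pcoef (nu : R) (w : C) : 0 <= nu -> Cmod w < 1 ->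
  convexity_order nu < Re (Cps (kcoef nu) w / Cps (pcoef nu) w)%C.
Proof.
  intros Hnu Hw. assert (Hw1 : Cmod w <= 1) by lra.
  assert (HP := Cps_pcoef_nz nu w Hnu Hw1).
  rewrite Cps_pcoef_factor in * by trivial. rewrite Cps_kcoef_factor by trivial.
  assert (BU := Cmod_Cpser_le (fun n => n) _ w Hw1 (ex_series_abs_tcoef nu Hnu)).
  assert (BY := Cmod_Cpser_le (fun n => n) _ w Hw1 (ex_series_abs_ycoef nu Hnu)).
  rewrite (Series_ext _ (tcoef nu)) in BU
    by (intros n; apply Rabs_pos_eq, tcoef_nonneg; lra).
  rewrite (Series_ext _ (ycoef nu)) in BY
    by (intros n; apply Rabs_pos_eq, ycoef_nonneg; lra).
  fold (uval nu) in BU. fold (yval nu) in BY.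
  set (F := Cps (bcoef nu) w) in *. set (U := Cps (tcoef nu) w) in *.
  set (Y := Cps (ycoef nu) w) in *.
  assert (HF : F <> 0) by (intros E; apply HP; rewrite E; ring).
  assert (HU : (1 - w * U)%C <> 0) by (intros E; apply HP; rewrite E; ring).
  replace (F * ((1 - w * U) * (1 - w * U) - 2 * w * Y) / (F * (1 - w * U)))%C
    with (1 - (w * U + 2 * (w * Y) / (1 - w * U)))%C by (field; split; trivial).
  set (Q := (w * U + 2 * (w * Y) / (1 - w * U))%C).
  assert (E : Re (1 - Q)%C = 1 - Re Q) by reflexivity. rewrite E.
  assert (HQ : Re Q <= Cmod Q).
  { eapply Rle_trans; [apply Rle_abs|apply re_le_Cmod]. }
  assert (Hu := uval_pos nu Hnu). assert (Hu3 := uval_le nu Hnu). assert (Hy := yval_nonneg nu Hnu).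
  assert (P0 := Cmod_ge_0 w). assert (P1 := Cmod_ge_0 U). assert (P2 := Cmod_ge_0 Y).
  assert (H1 : Cmod (w * U)%C < uval nu).
  { rewrite Cmod_mult. nra. }
  assert (H2 : Cmod (w * Y)%C <= yval nu).
  { rewrite Cmod_mult. nra. }
  assert (H3 : 1 - uval nu <= Cmod (1 - w * U)%C).
  { assert (T := Cmod_triangle (1 - w * U)%C (w * U)%C).
    replace (1 - w * U + w * U)%C with (RtoC 1) in T by ring. rewrite Cmod_1 in T. lra. }
  assert (H4 : Cmod (2 * (w * Y) / (1 - w * U))%C <= 2 * yval nu / (1 - uval nu)).
  { rewrite Cmod_div by trivial. rewrite Cmod_mult, Cmod_R, (Rabs_pos_eq 2) by lra.
    assert (P3 := Cmod_ge_0 (w * Y)%C).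
    apply Rmult_le_compat; try lra.
    - left. apply Rinv_0_lt_compat; lra.
    - apply Rinv_le_contravar; lra. }
  assert (H5 := Cmod_triangle (w * U)%C (2 * (w * Y) / (1 - w * U))%C).
  fold Q in H5. unfold convexity_order. lra.
Qed.

Lemma in_unit_disk_sqr (z : C) : in_unit_disk z -> Cmod (z ^ 2)%C < 1.
Proof.
  unfold in_unit_disk. intros Hz. rewrite Cmod_pow. assert (H := Cmod_ge_0 z). nra.
Qed.

Lemma convexity_quotient (nu : R) (z : C) : -1 < nu -> in_unit_disk z ->
  C_derive (bessel_g nu) z <> 0 ->
  (1 + z * C_derive (C_derive (bessel_g nu)) z / C_derive (bessel_g nu) z)%C
  = (Cps (kcoef nu) (z ^ 2) / Cps (pcoef nu) (z ^ 2))%C.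
Proof.
  intros Hnu Hz HP. rewrite <- C_derive2_bessel_g, <- C_derive_bessel_g by trivial.
  field. trivial.
Qed.

Lemma bessel_g_0 (nu : R) : -1 < nu -> bessel_g nu 0 = 0.
Proof.
  intros Hnu. rewrite bessel_g_Cpser by (trivial; rewrite Cmod_0; lra).
  unfold Cpser. rewrite (CSeries_ext _ (fun n => RtoC (0 * 0))).
  - rewrite CSeries_RtoC, Series_scal_l. f_equal. ring.
  - intros n. unfold odd_exp. rewrite Cpow_add_r, Cpow_1_r, Rmult_0_l. ring.
Qed.

Lemma in_unit_disk_0 : in_unit_disk 0.
Proof. unfold in_unit_disk. rewrite Cmod_0. lra. Qed.

Lemma C_derive_bessel_g_0 (nu : R) : -1 < nu -> C_derive (bessel_g nu) 0 = 1.
Proof.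
  intros Hnu. rewrite C_derive_bessel_g by (trivial; apply in_unit_disk_0).
  assert (H := ex_series_abs_pcoef nu Hnu).
  rewrite (Cps_shift (pcoef nu) (fun n => pcoef nu (S n)) 1); trivial.
  - replace (pcoef nu 0) with 1 by (unfold pcoef; simpl; ring). simpl. ring.
  - apply Cmod_pow_le_1. rewrite Cmod_0. lra.
  - apply ex_series_incr_1 in H. exact H.
  - intros n. ring.
Qed.

Lemma convex_of_order_bessel_g (nu alpha : R) : 0 <= nu -> alpha <= convexity_order nu ->
  convex_of_order alpha (bessel_g nu).
Proof.
  intros Hnu Ha. assert (Hnu1 : -1 < nu) by lra. repeat split.
  - apply bessel_g_0; trivial.
  - apply C_derive_bessel_g_0; trivial.
  - intros z Hz. eexists. apply is_C_derive_bessel_g; trivial.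
  - apply univalent_bessel_g; trivial.
  - rewrite C_derive_bessel_g by trivial. apply Cps_pcoef_nz; trivial.
    left. apply in_unit_disk_sqr; trivial.
  - rewrite convexity_quotient; trivial.
    + eapply Rle_lt_trans; [exact Ha|]. apply Re_kcoef_div_pcoef; trivial.
      apply in_unit_disk_sqr; trivial.
    + rewrite C_derive_bessel_g by trivial. apply Cps_pcoef_nz; trivial.
      left. apply in_unit_disk_sqr; trivial.
Qed.

(** * Necessity and the root *)

Definition Rps (c : nat -> R) (x : R) : R := Series (fun n => c n * x ^ n).

Lemma Cps_RtoC (c : nat -> R) (x : R) : Cps c (RtoC x) = RtoC (Rps c x).
Proof.
  unfold Cpser, Rps. rewrite <- CSeries_RtoC. apply CSeries_ext. intros n.
  rewrite RtoC_mult, RtoC_pow. reflexivity.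
Qed.

Lemma Rps_1 (c : nat -> R) : Rps c 1 = Series c.
Proof. apply Series_ext. intros n. rewrite pow1. ring. Qed.

Lemma Rps_Lipschitz (c : nat -> R) : ex_series (fun n => Rabs (c n)) ->
  ex_series (fun n => INR n * Rabs (c n)) ->
  exists L, 0 < L /\ forall x y, Rabs x <= 1 -> Rabs y <= 1 ->
    Rabs (Rps c x - Rps c y) <= L * Rabs (x - y).
Proof.
  intros H0 H1. exists (Rabs (Series (fun n => INR n * Rabs (c n))) + 1). split.
  - assert (H := Rabs_pos (Series (fun n => INR n * Rabs (c n)))). lra.
  - intros x y Hx Hy.
    assert (L := Cpser_Lipschitz (fun n => n) c (RtoC x) (RtoC y)).
    rewrite !Cps_RtoC, <- !RtoC_minus, !Cmod_R in L. specialize (L Hx Hy H0 H1).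
    eapply Rle_trans; [exact L|]. apply Rmult_le_compat_r; [apply Rabs_pos|].
    assert (H := Rle_abs (Series (fun n => INR n * Rabs (c n)))). lra.
Qed.

Lemma continuity_pt_Lipschitz (f : R -> R) (x d L : R) : 0 < d -> 0 < L ->
  (forall y, Rabs (y - x) < d -> Rabs (f y - f x) <= L * Rabs (y - x)) -> continuity_pt f x.
Proof.
  intros Hd HL H eps Heps. exists (Rmin d (eps / L)). split.
  - apply Rmin_glb_lt; trivial. apply Rdiv_lt_0_compat; trivial.
  - intros y [_ Hy]. simpl in *. unfold Rdist in *.
    assert (Y1 := Rlt_le_trans _ _ _ Hy (Rmin_l _ _)).
    assert (Y2 := Rlt_le_trans _ _ _ Hy (Rmin_r _ _)).
    eapply Rle_lt_trans; [apply H; trivial|].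
    apply (Rmult_lt_compat_l L) in Y2; trivial.
    replace (L * (eps / L)) with eps in Y2 by (field; lra). trivial.
Qed.

Lemma Series_ge_0_of_Rps (c : nat -> R) : ex_series (fun n => Rabs (c n)) ->
  ex_series (fun n => INR n * Rabs (c n)) ->
  (forall x, 0 <= x < 1 -> 0 <= Rps c x) -> 0 <= Series c.
Proof.
  intros H0 H1 Hp. destruct (Rps_Lipschitz c H0 H1) as (L & HL & Hlip).
  rewrite <- Rps_1. apply Rnot_lt_le. intros Hneg.
  set (m := - Rps c 1) in *. assert (Hm : 0 < m) by (unfold m; lra).
  set (x := 1 - Rmin 1 (m / (2 * L))).
  assert (Q : 0 < m / (2 * L)) by (apply Rdiv_lt_0_compat; lra).
  assert (B1 := Rmin_l 1 (m / (2 * L))). assert (B2 := Rmin_r 1 (m / (2 * L))).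
  assert (B3 : 0 < Rmin 1 (m / (2 * L))) by (apply Rmin_glb_lt; lra).
  assert (Hx : 0 <= x < 1) by (unfold x; lra).
  specialize (Hlip x 1). rewrite Rabs_R1, (Rabs_pos_eq x) in Hlip by lra.
  specialize (Hlip ltac:(lra) ltac:(lra)).
  assert (P := Hp x Hx). rewrite Rabs_pos_eq in Hlip by (unfold m in Hm; lra).
  rewrite (Rabs_left (x - 1)) in Hlip by lra.
  assert (L * - (x - 1) <= m / 2).
  { replace (m / 2) with (L * (m / (2 * L))) by (field; lra).
    apply Rmult_le_compat_l; unfold x; lra. }
  unfold m in *. lra.
Qed.

Lemma Rps_pos_of_nz (c : nat -> R) : ex_series (fun n => Rabs (c n)) ->
  ex_series (fun n => INR n * Rabs (c n)) -> 0 < c 0%nat ->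
  (forall x, 0 <= x < 1 -> Rps c x <> 0) -> forall x, 0 <= x < 1 -> 0 < Rps c x.
Proof.
  intros H0 H1 Hc Hnz x Hx. destruct (Rps_Lipschitz c H0 H1) as (L & HL & Hlip).
  destruct (Rlt_le_dec 0 (Rps c x)) as [|Hle]; trivial. exfalso.
  assert (Hneg : Rps c x < 0) by (assert (H := Hnz x Hx); lra).
  assert (E0 : Rps c 0 = c 0%nat).
  { apply RtoC_inj. rewrite <- Cps_RtoC, (Cps_shift c (fun n => c (S n)) 1); trivial.
    - ring.
    - rewrite Cmod_0; lra.
    - apply ex_series_incr_1 in H0. exact H0.
    - intros n. ring. }
  assert (Hx0 : 0 < x).
  { destruct (Req_dec x 0) as [E|]; [|lra]. rewrite E, E0 in Hneg. lra. }
  destruct (IVT_interv (fun y => - Rps c y) 0 x) as (z & Hz & E).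
  - intros y Hy. apply (continuity_pt_Lipschitz _ y (1 - x) L); trivial; [lra|].
    intros v Hv. apply Rabs_def2 in Hv.
    replace (- Rps c v - - Rps c y) with (- (Rps c v - Rps c y)) by ring. rewrite Rabs_Ropp.
    apply Hlip; apply Rabs_le; lra.
  - trivial.
  - rewrite E0. lra.
  - lra.
  - apply (Hnz z); lra.
Qed.

Lemma ex_series_n_pkcoef (nu : R) (k : nat) : -1 < nu -> (k <= 2)%nat ->
  ex_series (fun n => INR n * Rabs ((2 * INR n + 1) ^ k * bcoef nu n)).
Proof.
  intros Hnu Hk. eapply ex_series_ext;
    [|apply (ex_series_weight_bcoef nu (fun n => INR n * (2 * INR n + 1) ^ k) Hnu)].
  - intros n. assert (H := pos_INR n). cbv beta.
    rewrite Rmult_assoc, (Rabs_mult (INR n)), (Rabs_pos_eq (INR n)); trivial.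
  - intros n. assert (H := pos_INR n).
    assert (0 <= (2 * INR n + 1) ^ k) by (apply pow_le; lra). split; [apply Rmult_le_pos; lra|].
    assert ((2 * INR n + 1) ^ k <= (2 * INR n + 1) ^ 2) by (apply Rle_pow; [lra|lia]).
    assert (INR n * (2 * INR n + 1) ^ k <= (2 * INR n + 1) * (2 * INR n + 1) ^ 2)
      by (apply Rmult_le_compat; lra).
    assert (0 <= (2 * INR n + 1) ^ 3) by (apply pow_le; lra). simpl in *. lra.
Qed.

Lemma Series_bcoef_pos (nu : R) : 0 <= nu -> 0 < Series (bcoef nu).
Proof.
  intros Hnu. assert (H1 : Cmod 1 <= 1) by (rewrite Cmod_1; lra).
  assert (H := Cmod_Cps_pcoef_minus_1 nu 1 Hnu H1).
  rewrite Cps_pcoef_factor, !Cps_1 in H by trivial. fold (uval nu) in H.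
  assert (E : (Series (bcoef nu) * (1 - 1 * uval nu) - 1)%C
     = RtoC (Series (bcoef nu) * (1 - uval nu) - 1)).
  { rewrite !RtoC_minus, RtoC_mult, RtoC_minus. ring. }
  rewrite E, Cmod_R in H. apply Rabs_def2 in H. assert (Hu := uval_le nu Hnu).
  apply (Rmult_lt_reg_r (1 - uval nu)); lra.
Qed.

Lemma Series_dcoef (nu : R) : 0 <= nu -> Series (dcoef nu) = uval nu * Series (bcoef nu).
Proof.
  intros Hnu. assert (E := Cps_dcoef nu 1 Hnu ltac:(rewrite Cmod_1; lra)).
  rewrite !Cps_1, <- RtoC_mult in E. apply RtoC_inj in E. exact E.
Qed.

Lemma Series_dcoef_pos (nu : R) : -1 < nu -> 0 < Series (dcoef nu).
Proof.
  intros Hnu. assert (H := Series_bcoef_pos (nu + 1) ltac:(lra)).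
  rewrite (Series_ext (bcoef (nu + 1)) (fun n => 2 * (nu + 1) * dcoef nu n)) in H
    by (intros; apply bcoef_succ; trivial).
  rewrite Series_scal_l in H. apply (Rmult_lt_reg_l (2 * (nu + 1))); lra.
Qed.

Lemma Series_pcoef (nu : R) : -1 < nu ->
  Series (pcoef nu) = Series (bcoef nu) - Series (dcoef nu).
Proof.
  intros Hnu. assert (E := Cps_pcoef nu 1 Hnu ltac:(rewrite Cmod_1; lra)).
  rewrite !Cps_1, Cmult_1_l, <- RtoC_minus in E. apply RtoC_inj in E. exact E.
Qed.

Lemma Series_kcoef (nu : R) : -1 < nu ->
  Series (kcoef nu) = (2 * nu - 2) * Series (dcoef nu).
Proof.
  intros Hnu. assert (E := Cps_kcoef nu 1 Hnu ltac:(rewrite Cmod_1; lra)).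
  rewrite !Cps_1 in E. apply RtoC_inj. rewrite E.
  rewrite !RtoC_mult, !RtoC_minus, !RtoC_mult. ring.
Qed.

Lemma convex_of_order_bessel_g_inv (nu alpha : R) : -1 < nu -> 0 <= alpha ->
  convex_of_order alpha (bessel_g nu) -> 0 <= nu /\ alpha <= convexity_order nu.
Proof.
  intros Hnu Ha (_ & _ & _ & _ & Hc).
  assert (Hb := ex_series_abs_bcoef nu Hnu).
  assert (Sp := ex_series_abs_pcoef nu Hnu). assert (Sk := ex_series_abs_kcoef nu Hnu).
  assert (Sp1 : ex_series (fun n => INR n * Rabs (pcoef nu n))).
  { eapply ex_series_ext; [|apply (ex_series_n_pkcoef nu 1 Hnu); lia].
    intros n. cbv beta. rewrite pow_1. reflexivity. }
  assert (Sk1 := ex_series_n_pkcoef nu 2 Hnu ltac:(lia)). fold (kcoef nu) in Sk1.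
  assert (A : forall x, 0 <= x < 1 -> Rps (pcoef nu) x <> 0 /\
     alpha < Rps (kcoef nu) x / Rps (pcoef nu) x).
  { intros x Hx. assert (Hs := sqrt_pos x).
    assert (Hs2 := sqrt_sqrt x ltac:(lra)).
    assert (Hz : in_unit_disk (RtoC (sqrt x))).
    { unfold in_unit_disk. rewrite Cmod_R, Rabs_pos_eq by trivial. nra. }
    destruct (Hc _ Hz) as [N Q]. rewrite convexity_quotient in Q by trivial.
    rewrite C_derive_bessel_g in N by trivial.
    assert (E : (RtoC (sqrt x) ^ 2)%C = RtoC x).
    { rewrite <- RtoC_pow. f_equal. simpl. lra. }
    rewrite E, !Cps_RtoC in *.
    assert (N1 : Rps (pcoef nu) x <> 0) by (intros Z; apply N; rewrite Z; reflexivity).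
    rewrite <- RtoC_div in Q by trivial. split; trivial. }
  assert (P : forall x, 0 <= x < 1 -> 0 < Rps (pcoef nu) x).
  { apply Rps_pos_of_nz; trivial.
    - unfold pcoef; simpl; lra.
    - intros x Hx. apply A; trivial. }
  assert (P1 : 0 <= Series (pcoef nu)).
  { apply Series_ge_0_of_Rps; trivial. intros x Hx. left. auto. }
  set (c := fun n => kcoef nu n - alpha * pcoef nu n).
  assert (K1 : 0 <= Series c).
  { apply Series_ge_0_of_Rps.
    - apply (ex_series_Rabs_le _ (fun n => Rabs (kcoef nu n) + alpha * Rabs (pcoef nu n))).
      + intros n. unfold c, Rminus. eapply Rle_trans; [apply Rabs_triang|].
        rewrite Rabs_Ropp, Rabs_mult, (Rabs_pos_eq alpha); lra.
      + apply (ex_series_plus (V := R_NormedModule)); trivial.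
        apply (ex_series_scal_l (V := R_NormedModule)); trivial.
    - apply (ex_series_le_abs _ (fun n => INR n * Rabs (kcoef nu n)
          + alpha * (INR n * Rabs (pcoef nu n)))).
      + intros n. unfold c, Rminus. assert (H := pos_INR n).
        rewrite Rabs_mult, Rabs_Rabsolu, (Rabs_pos_eq (INR n)) by trivial.
        assert (T := Rabs_triang (kcoef nu n) (- (alpha * pcoef nu n))).
        rewrite Rabs_Ropp, Rabs_mult, (Rabs_pos_eq alpha) in T by trivial. nra.
      + apply (ex_series_plus (V := R_NormedModule)); trivial.
        apply (ex_series_scal_l (V := R_NormedModule)); trivial.
    - intros x Hx. destruct (A x Hx) as [_ Q]. assert (Px := P x Hx).
      assert (Hx1 : Cmod (RtoC x) <= 1) by (rewrite Cmod_R, Rabs_pos_eq; lra).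
      assert (E : Rps c x = Rps (kcoef nu) x - alpha * Rps (pcoef nu) x).
      { apply RtoC_inj. rewrite <- Cps_RtoC.
        rewrite (Cpser_ext _ (fun n => n) c (fun n => 1 * kcoef nu n + - alpha * pcoef nu n));
          [|reflexivity|intros n; unfold c; ring].
        rewrite Cpser_lin by trivial. rewrite !Cps_RtoC, RtoC_minus, RtoC_opp, RtoC_mult. ring. }
      rewrite E. apply (Rmult_lt_compat_r (Rps (pcoef nu) x)) in Q; trivial.
      unfold Rdiv in Q. rewrite Rmult_assoc, Rinv_l in Q by lra. lra. }
  unfold c in K1. rewrite Series_minus, Series_scal_l in K1.
  - rewrite Series_kcoef in K1 by trivial.
    assert (Dp := Series_dcoef_pos nu Hnu).
    assert (Hnu1 : 1 <= nu).
    { apply Rnot_lt_le. intros Hlt.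
      assert (0 <= alpha * Series (pcoef nu)) by (apply Rmult_le_pos; trivial). nra. }
    split; [lra|].
    assert (Hnu0 : 0 <= nu) by lra.
    rewrite Series_pcoef, Series_dcoef in K1 by lra.
    rewrite convexity_order_eq by trivial.
    assert (Hu := uval_le nu Hnu0). assert (Bp := Series_bcoef_pos nu Hnu0).
    apply (Rmult_le_reg_r (1 - uval nu)); [lra|].
    unfold Rdiv. rewrite Rmult_assoc, Rinv_l by lra.
    apply (Rmult_le_reg_r (Series (bcoef nu))); [trivial|]. lra.
  - apply ex_series_Rabs; trivial.
  - apply (ex_series_scal_l (V := R_NormedModule)), ex_series_Rabs; trivial.
Qed.

Lemma Rabs_bcoef_le_pow4 (nu : R) (n : nat) : 0 <= nu -> Rabs (bcoef nu n) <= (/ 4) ^ n.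
Proof.
  intros Hnu. induction n as [|n IH]; [simpl; rewrite Rabs_R1; lra|].
  rewrite Rabs_bcoef_S by lra. assert (H := pos_INR n). simpl pow. rewrite (Rmult_comm (/ 4)).
  apply Rmult_le_compat; trivial; [apply Rabs_pos| |].
  - left. apply Rinv_0_lt_compat. apply Rmult_lt_0_compat; lra.
  - apply Rinv_le_contravar; [lra|]. nra.
Qed.

Lemma bcoef_Lipschitz (nu mu : R) (n : nat) : 0 <= nu -> 0 <= mu ->
  Rabs (bcoef nu n - bcoef mu n) <= (/ 2) ^ n * Rabs (nu - mu).
Proof.
  intros Hnu Hmu. assert (Hd := Rabs_pos (nu - mu)). induction n as [|n IH].
  - simpl. rewrite Rminus_diag, Rabs_R0. lra.
  - assert (H := pos_INR n). cbn [bcoef]. rewrite !S_INR.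
    set (x := bcoef nu n) in *. set (y := bcoef mu n) in *. set (N := INR n + 1).
    assert (HN : 1 <= N) by (unfold N; lra).
    replace (- x / (4 * N * (nu + N)) - - y / (4 * N * (mu + N)))
      with (- ((x - y) * / (4 * N * (nu + N)))
            + (y * ((nu - mu) * / (4 * N * (nu + N) * (mu + N))))) by (field; lra).
    eapply Rle_trans; [apply Rabs_triang|]. rewrite Rabs_Ropp, !Rabs_mult.
    assert (B := Rabs_bcoef_le_pow4 mu n Hmu). fold y in B.
    assert (B2 : (/ 4) ^ n <= (/ 2) ^ n) by (apply pow_incr; lra).
    assert (D1 : Rabs (/ (4 * N * (nu + N))) <= / 4).
    { rewrite Rabs_pos_eq.
      - apply Rinv_le_contravar; nra.
      - left. apply Rinv_0_lt_compat. nra. }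
    assert (D2 : Rabs (/ (4 * N * (nu + N) * (mu + N))) <= / 4).
    { assert (1 <= N * (nu + N)) by nra. assert (1 <= N * (nu + N) * (mu + N)) by nra.
      rewrite Rabs_pos_eq.
      - apply Rinv_le_contravar; nra.
      - left. apply Rinv_0_lt_compat. nra. }
    assert (E1 : Rabs (x - y) * Rabs (/ (4 * N * (nu + N))) <= (/ 2) ^ n * Rabs (nu - mu) * / 4)
      by (apply Rmult_le_compat; trivial; apply Rabs_pos).
    assert (E2 : Rabs y * (Rabs (nu - mu) * Rabs (/ (4 * N * (nu + N) * (mu + N))))
      <= (/ 2) ^ n * (Rabs (nu - mu) * / 4)).
    { apply Rmult_le_compat; try apply Rabs_pos.
      - apply Rmult_le_pos; apply Rabs_pos.
      - lra.
      - apply Rmult_le_compat_l; trivial. }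
    simpl pow. lra.
Qed.

Lemma continuity_pt_Series_bcoef (nu : R) : 0 < nu ->
  continuity_pt (fun v => Series (bcoef v)) nu.
Proof.
  intros Hnu. apply (continuity_pt_Lipschitz _ nu nu 2); [trivial|lra|].
  intros v Hv. apply Rabs_def2 in Hv. assert (Hv0 : 0 <= v) by lra.
  assert (H2 : Rabs (/ 2) < 1) by (rewrite Rabs_pos_eq; lra).
  rewrite <- Series_minus by (apply ex_series_Rabs, ex_series_abs_bcoef; lra).
  assert (G : ex_series (fun n => (/ 2) ^ n * Rabs (v - nu)))
    by (apply ex_series_scal_r, ex_series_geom; trivial).
  assert (L : forall n, Rabs (bcoef v n - bcoef nu n) <= (/ 2) ^ n * Rabs (v - nu))
    by (intros; apply bcoef_Lipschitz; lra).
  eapply Rle_trans; [apply Series_Rabs, (ex_series_Rabs_le _ _ L), G|].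
  eapply Rle_trans; [apply (Series_le _ (fun n => (/ 2) ^ n * Rabs (v - nu)))|].
  - intros n. split; [apply Rabs_pos|apply L].
  - trivial.
  - rewrite Series_scal_r, Series_geom by trivial. right. field.
Qed.

Lemma equation_iff (nu alpha : R) : 0 <= nu ->
  ((2 * nu + alpha - 2) * Series (dcoef nu) = alpha * Series (bcoef nu)
   <-> convexity_order nu = alpha).
Proof.
  intros Hnu. rewrite Series_dcoef, convexity_order_eq by trivial.
  assert (Hu := uval_le nu Hnu). assert (Bp := Series_bcoef_pos nu Hnu). split; intros H.
  - apply (Rmult_eq_reg_r (1 - uval nu)); [|lra].
    unfold Rdiv. rewrite Rmult_assoc, Rinv_l by lra.
    apply (Rmult_eq_reg_r (Series (bcoef nu))); lra.
  - assert (E : (2 * nu - 2) * uval nu = alpha * (1 - uval nu)) by (rewrite <- H; field; lra).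
    replace ((2 * nu + alpha - 2) * (uval nu * Series (bcoef nu)))
      with (((2 * nu - 2) * uval nu + alpha * uval nu) * Series (bcoef nu)) by ring.
    rewrite E. ring.
Qed.

Lemma convexity_order_1 : convexity_order 1 = 0.
Proof.
  rewrite convexity_order_eq by lra. unfold Rdiv. ring.
Qed.

Lemma convexity_order_surj (alpha : R) : 0 <= alpha < 1 ->
  exists nu, 0 <= nu /\ convexity_order nu = alpha.
Proof.
  intros [Ha Ha1]. destruct (Req_dec alpha 0) as [->|Hn].
  - exists 1. split; [lra|apply convexity_order_1].
  - set (h := fun v => (2 * v + alpha - 2) * Series (bcoef (v + 1))
         - 2 * (v + 1) * alpha * Series (bcoef v)).
    assert (E : forall v, 0 <= v -> h v = 2 * (v + 1) *
       (((2 * v + alpha - 2) * uval v - alpha) * Series (bcoef v))).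
    { intros v Hv. unfold h.
      rewrite (Series_ext (bcoef (v + 1)) (fun n => 2 * (v + 1) * dcoef v n))
        by (intros; apply bcoef_succ; lra).
      rewrite Series_scal_l, Series_dcoef by trivial. ring. }
    set (M := 4 / (1 - alpha)).
    assert (HM : M * (1 - alpha) = 4) by (unfold M; field; lra).
    assert (HM1 : 1 < M) by nra.
    destruct (IVT_interv h 1 M) as (z & Hz & Ez); trivial.
    + intros v Hv. unfold h. apply continuity_pt_minus; apply continuity_pt_mult.
      * apply derivable_continuous_pt. reg.
      * apply (continuity_pt_comp (fun v => v + 1) (fun v => Series (bcoef v))).
        -- apply derivable_continuous_pt. reg.
        -- apply continuity_pt_Series_bcoef. lra.
      * apply derivable_continuous_pt. reg.
      * apply continuity_pt_Series_bcoef. lra.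
    + rewrite E by lra. assert (Bp := Series_bcoef_pos 1 ltac:(lra)).
      assert (Hu := uval_le 1 ltac:(lra)).
      assert (0 < alpha * (1 - uval 1) * Series (bcoef 1))
        by (repeat apply Rmult_lt_0_compat; lra). lra.
    + rewrite E by lra. assert (Bp := Series_bcoef_pos M ltac:(lra)).
      assert (Hu := uval_ge M ltac:(lra)).
      assert (Q : alpha < (2 * M + alpha - 2) * uval M).
      { apply Rlt_le_trans with ((2 * M + alpha - 2) * / (2 * (1 + M))).
        - apply (Rmult_lt_reg_r (2 * (1 + M))); [lra|].
          rewrite Rmult_assoc, Rinv_l by lra. lra.
        - apply Rmult_le_compat_l; lra. }
      repeat apply Rmult_lt_0_compat; lra.
    + exists z. split; [lra|]. apply equation_iff; [lra|]. rewrite Series_dcoef by lra.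
      rewrite E in Ez by lra.
      apply Rmult_integral in Ez. destruct Ez as [Ez|Ez]; lra.
Qed.

Theorem theorem5 :
  (forall alpha : R, 0 <= alpha < 1 ->
     exists nu_alpha : R,
       unique
         (fun nu : R =>
            0 <= nu /\
            (RtoC (2 * nu + alpha - 2) * BesselJ (nu + 1) 1
             = RtoC alpha * BesselJ nu 1)%C)
         nu_alpha /\
       (forall nu : R, nu > -1 ->
          (convex_of_order alpha (bessel_g nu) <-> nu >= nu_alpha))) /\
  (forall nu : R, nu > -1 ->
     (convex_in_disk (bessel_g nu) <-> nu >= 1)).
Proof.
  assert (Char : forall alpha nu0 nu, 0 <= alpha -> 0 <= nu0 -> convexity_order nu0 = alpha ->
    nu > -1 -> (convex_of_order alpha (bessel_g nu) <-> nu >= nu0)).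
  { intros alpha nu0 nu Ha H0 E Hnu. split.
    - intros Hc. destruct (convex_of_order_bessel_g_inv nu alpha Hnu Ha Hc) as [Hn Hle].
      apply Rle_ge, Rnot_lt_le. intros Hlt.
      assert (H := convexity_order_increasing nu nu0 Hn Hlt). lra.
    - intros Hge. apply convex_of_order_bessel_g; [lra|].
      destruct (Req_dec nu0 nu) as [<-|Hn]; [lra|].
      assert (H := convexity_order_increasing nu0 nu H0 ltac:(lra)). lra. }
  split.
  - intros alpha Ha. destruct (convexity_order_surj alpha Ha) as (nu0 & H0 & E).
    exists nu0. split; [split|].
    + split; trivial. apply BesselJ_equation_iff; [lra|]. apply equation_iff; trivial.
    + intros mu [Hmu Heq]. apply BesselJ_equation_iff in Heq; [|lra].
      apply equation_iff in Heq; trivial.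
      destruct (Rtotal_order nu0 mu) as [Hlt|[Heq'|Hgt]]; trivial; exfalso.
      * assert (H := convexity_order_increasing nu0 mu H0 Hlt). lra.
      * assert (H := convexity_order_increasing mu nu0 Hmu Hgt). lra.
    + intros nu Hnu. apply Char; trivial. lra.
  - intros nu Hnu. apply (Char 0 1); trivial; try lra. apply convexity_order_1.
Qed.
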